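(* There exist universal constants $c_1,c_2>0$ such that, for every $0<a\leq b$, every $T>0$ and every integer $n\geq 2$, $$c_1\,\frac{T(1+b^2)}{a}\;\leq\; \gamma(a,b,T,n)\;\leq\; c_2\,\frac{T(1+n b^2)}{a}.$$
   Context: Let $c:[0,\infty)\to\mathbb{R}^n$ be a measurable function such that $cc^\top$ is locally integrable and satisfies the persistent excitation condition $$a\,\mathrm{Id}_n \le \int_t^{t+T} c(\tau)c(\tau)^\top\,d\tau\le b\,\mathrm{Id}_n\qquad\text{for all } t\ge 0 \tag{PE}$$ (in the sense of quadratic forms). For $u\in L_2([0,\infty),\mathbb{R}^n)$, let $x_u$ be the solution of $\dot x(t)=-c(t)c(t)^\top x(t)+u(t)$ with $x(0)=0$; it belongs to $L_2([0,\infty),\mathbb{R}^n)$. The $L_2$-gain of $c$ is $$\gamma(c)=\sup_{0\ne u\in L_2([0,\infty),\mathbb{R}^n)}\frac{\|x_u\|_2}{\|u\|_2},$$ where $\|\cdot\|_2$ is the norm of $L_2([0,\infty),\mathbb{R}^n)$, and $$\gamma(a,b,T,n):=\sup\{\gamma(c)\mid cc^\top\text{ satisfies (PE) with parameters }a,b,T\}.$$ *)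

(* Defs.v *)
From mathcomp Require Import all_boot all_order all_algebra.
From mathcomp Require Import all_classical all_reals all_analysis.
Set Implicit Arguments.
Unset Strict Implicit.
Unset Printing Implicit Defensive.
Import Order.TTheory GRing.Theory Num.Theory.
Import numFieldNormedType.Exports.
Local Open Scope classical_set_scope.
Local Open Scope ring_scope.

Section MatrixValuedFunctions.
Context {R : realType}.
Local Notation mu := (@lebesgue_measure R).

Definition mx_measurable m n (D : set R) (F : R -> 'M[R]_(m, n)) : Prop :=
  forall i j, measurable_fun D (fun t => F t i j).

Definition mx_integrable m n (D : set R) (F : R -> 'M[R]_(m, n)) : Prop :=
  forall i j, mu.-integrable D (EFin \o (fun t => F t i j)).

Definition mx_integral m n (D : set R) (F : R -> 'M[R]_(m, n)) : 'M[R]_(m, n) :=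
  \matrix_(i, j) \int[mu]_(t in D) F t i j.

(* The library notion [locally_integrable] only covers open domains. *)
Definition halfline_locally_integrable m n (F : R -> 'M[R]_(m, n)) : Prop :=
  forall t, 0 <= t -> mx_integrable `[0, t] F.

Definition quad_form n (A : 'M[R]_n) (v : 'cV[R]_n) : R := (v^T *m A *m v) 0 0.

Definition quad_form_le n (A B : 'M[R]_n) : Prop :=
  forall v, quad_form A v <= quad_form B v.

(* The norm that the library puts on 'cV[R]_n is the sup norm. *)
Definition euclidean_norm n (v : 'cV[R]_n) : R :=
  Num.sqrt (\sum_(i < n) v i 0 ^+ 2).

(* A function on the half-line is represented by a function on R whose values
   at negative arguments are ignored; here they are replaced by 0. *)
Definition L2norm n (u : R -> 'cV[R]_n) : \bar R :=
  let N := (EFin \o (fun t => euclidean_norm (u t))) \_ `[0, +oo[ in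
  'N[mu]_2%:E[N]%E.

Definition in_L2 n (u : R -> 'cV[R]_n) : Prop :=
  mx_measurable `[0, +oo[ u /\ (L2norm u < +oo)%E.

End MatrixValuedFunctions.

Section Gain.
Context {R : realType}.

(* The local integrability of c c^T makes the integral meaningful:
   [mx_integral] is total. *)
Definition persistently_exciting n (a b T : R) (c : R -> 'cV[R]_n) : Prop :=
  let M t := c t *m (c t)^T in
  [/\ mx_measurable `[0, +oo[ c,
      halfline_locally_integrable M &
      forall t, 0 <= t ->
        quad_form_le a%:M (mx_integral `[t, t + T] M) /\
        quad_form_le (mx_integral `[t, t + T] M) b%:M].

(* Caratheodory solution of x' = - c c^T x + u, x(0) = 0: since c and u are only
   measurable, the equation is understood in integrated form. *)
Definition is_solution n (c u x : R -> 'cV[R]_n) : Prop :=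
  let f t := - (c t *m (c t)^T *m x t) + u t in
  halfline_locally_integrable f /\
  forall t, 0 <= t -> x t = mx_integral `[0, t] f.

Definition L2gain n (c : R -> 'cV[R]_n) : \bar R :=
  ereal_sup [set r | exists u x : R -> 'cV[R]_n,
    [/\ in_L2 u, L2norm u != 0%E, is_solution c u x &
        r = (L2norm x / L2norm u)%E]].

Definition worst_L2gain (a b T : R) (n : nat) : \bar R :=
  ereal_sup [set L2gain c | c in @persistently_exciting n a b T].

End Gain.

(* Main.v *)
Require Import Defs.
From mathcomp Require Import all_boot all_order all_algebra.
From mathcomp Require Import all_classical all_reals all_analysis.
From mathcomp Require Import measurable_realfun ring lra.
Set Implicit Arguments.
Unset Strict Implicit.
Unset Printing Implicit Defensive.
Import Order.TTheory GRing.Theory Num.Theory.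
Import numFieldNormedType.Exports.
Local Open Scope classical_set_scope.
Local Open Scope ring_scope.

(* Write y = c . x, so that d|x|^2/dt = 2 (x . u - y^2).

   Upper bound.  On a window [s, s + T], x(s) . c = y + c . w - c . z, where
   w and z are the integrals of c y and of u from s.  Duality with (PE) gives
   |w|^2 <= b int y^2, the trace of (PE) gives int |c|^2 <= n b, and so
   a |x(s)|^2 <= 3 (1 + n b^2) int y^2 + 3 n b T int |u|^2.  The energy balance
   bounds int y^2 by int x . u; summing over windows and absorbing int |x|^2
   with AM-GM yields |x|_2 <= 5 T (1 + n b^2) / a |u|_2.

   Lower bound.  If xi' = - c c^T xi decays slowly on [0, M], the pair
   x = phi xi, u = phi' xi with phi t = t (M - t)_+^2 shows that the gain is at
   least of order M.  For bounded b let the components of c be bumps with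
   disjoint supports: the first one decays at mean rate a / T.  For large b let
   the first two components of c describe a line turning slowly in the time
   int |c|^2, by a small angle per period when a << b: the state follows the
   line's orthogonal direction and loses only a fraction of order a / b^2 of
   itself per period. *)

Notation itg s t f := (\int[lebesgue_measure]_(r in [set` `[s, t]]) f r).

(** * Integrals over compact subintervals of the half-line *)

Section IntervalIntegral.
Context {R : realType}.
Local Notation mu := (@lebesgue_measure R).
Implicit Types (f g h : R -> R) (s t r : R).

Definition locint f := forall t, 0 <= t -> mu.-integrable `[0, t] (EFin \o f).

Lemma locint_itv f s t : locint f -> 0 <= s -> mu.-integrable `[s, t] (EFin \o f).
Proof.
move=> lf s0; have [st|ts] := leP s t; last first.
  by rewrite set_itv_ge ?bnd_simp -?ltNge//; exact: integrable_set0.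
apply: integrableS (lf t (le_trans s0 st)) => //.
by apply: subset_itvr; rewrite bnd_simp.
Qed.

Lemma locint_measurable f : locint f -> measurable_fun (`[0, +oo[ : set R) f.
Proof.
move=> lf; have -> : (`[0, +oo[%classic : set R) = \bigcup_k `[0, k%:R : R]%classic.
  apply/seteqP; split => [x /=|x [k _]] /=; rewrite !in_itv/= ?andbT.
    move=> x0; exists (Num.truncn x).+1 => //=; rewrite in_itv/= x0/=.
    by apply/ltW/truncnS_gt.
  by move=> /andP[].
apply/measurable_fun_bigcup => // k.
by have /measurable_int/measurable_EFinP := lf k%:R (ler0n _ _).
Qed.

Lemma eq_locint f g : (forall t, 0 <= t -> f t = g t) -> locint f -> locint g.
Proof.
move=> fg lf t t0; apply: eq_integrable (lf t t0) => //= x.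
by rewrite inE/= in_itv/= => /andP[x0 _]; rewrite fg.
Qed.

Lemma locintD f g : locint f -> locint g -> locint (fun t => f t + g t).
Proof. by move=> lf lg t t0; exact: (integrableD _ (lf t t0) (lg t t0)). Qed.

Lemma locintZ k f : locint f -> locint (fun t => k * f t).
Proof. by move=> lf t t0; exact: (integrableZl _ _ (lf t t0)). Qed.

Lemma locintN f : locint f -> locint (fun t => - f t).
Proof.
by move=> lf; apply: eq_locint (locintZ (-1) lf) => t _; rewrite mulN1r.
Qed.

Lemma locintB f g : locint f -> locint g -> locint (fun t => f t - g t).
Proof. by move=> lf lg; apply: locintD => //; exact: locintN. Qed.

Lemma locint_sum (I : Type) (l : seq I) (P : pred I) (F : I -> R -> R) :
  (forall i, P i -> locint (F i)) -> locint (fun t => \sum_(i <- l | P i) F i t).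
Proof.
move=> lF t t0.
have := @integrable_sum _ _ _ mu `[0, t]%classic (measurable_itv _) I l P (fun i => EFin \o F i).
move=> /(_ (fun i Pi => lF i Pi t t0)); apply: eq_integrable => // x _.
by rewrite /= sumEFin.
Qed.

Lemma locint_le f g : measurable_fun (`[0, +oo[ : set R) f ->
  (forall t, 0 <= t -> `|f t| <= g t) -> locint g -> locint f.
Proof.
move=> mf fg lg t t0; apply: le_integrable (lg t t0) => //.
  apply/measurable_EFinP; apply: measurable_funS mf => //.
  by move=> x /=; rewrite !in_itv/= => /andP[->].
move=> x /=; rewrite in_itv/= => /andP[x0 _]; rewrite lee_fin.
by rewrite (le_trans (fg x x0))// ler_norm.
Qed.

Lemma itg_additive f s r t : locint f -> 0 <= s -> s <= r -> r <= t ->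
  itg s t f = itg s r f + itg r t f.
Proof.
move=> lf s0 sr rt; have r0 := le_trans s0 sr.
have := @Rintegral_itvB R f (BLeft s) (BRight t) r (locint_itv t lf s0).
rewrite !bnd_simp => /(_ sr rt) H.
apply/eqP; rewrite addrC -subr_eq; apply/eqP; rewrite H.
apply: Rintegral_itv_obnd_cbnd.
by apply: integrableS (locint_itv t lf r0) => //; exact: subset_itv_oc_cc.
Qed.

Lemma itgD f g s t : locint f -> locint g -> 0 <= s ->
  itg s t (fun t => f t + g t) = itg s t f + itg s t g.
Proof. by move=> lf lg s0; apply: RintegralD => //; exact: locint_itv. Qed.

Lemma itgB f g s t : locint f -> locint g -> 0 <= s ->
  itg s t (fun t => f t - g t) = itg s t f - itg s t g.
Proof. by move=> lf lg s0; apply: RintegralB => //; exact: locint_itv. Qed.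

Lemma itgZ k f s t : locint f -> 0 <= s ->
  itg s t (fun t => k * f t) = k * itg s t f.
Proof. by move=> lf s0; apply: RintegralZl => //; exact: locint_itv. Qed.

Lemma itg_le f g s t : locint f -> locint g -> 0 <= s ->
  (forall r, s <= r <= t -> f r <= g r) -> itg s t f <= itg s t g.
Proof.
by move=> lf lg s0 fg; apply: le_Rintegral => //; exact: locint_itv.
Qed.

Lemma eq_itg f g s t : (forall r, s <= r <= t -> f r = g r) -> itg s t f = itg s t g.
Proof. by move=> fg; apply: eq_Rintegral => x; rewrite inE/= in_itv => /fg. Qed.

Lemma itg_ge0 f s t : (forall r, s <= r <= t -> 0 <= f r) -> 0 <= itg s t f.
Proof. by move=> f0; apply: Rintegral_ge0 => x /=; rewrite in_itv => /f0. Qed.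

Lemma itg_cst k s t : s <= t -> itg s t (fun=> k) = k * (t - s).
Proof.
move=> st; rewrite Rintegral_cst//= lebesgue_measure_itv/= lte_fin.
by case: ltgtP st => //= -> _; rewrite subrr.
Qed.

Lemma itg_sum n (F : 'I_n -> R -> R) s t : (forall i, locint (F i)) -> 0 <= s ->
  itg s t (fun t => \sum_i F i t) = \sum_i itg s t (F i).
Proof.
move=> lF s0; rewrite /Rintegral.
under eq_integral do rewrite -sumEFin.
rewrite integral_sum//=; last by move=> i; exact: locint_itv.
rewrite -sum_fine//= => i _; apply: integrable_fin_num => //.
exact: locint_itv.
Qed.

Lemma itg_nonincr_dom f s t t' : locint f -> 0 <= s -> s <= t -> t <= t' ->
  (forall r, 0 <= r -> 0 <= f r) -> itg s t f <= itg s t' f.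
Proof.
move=> lf s0 st tt' f0; rewrite (itg_additive lf s0 st tt') lerDl.
by apply: itg_ge0 => r /andP[tr _]; rewrite f0// (le_trans _ tr)// (le_trans s0).
Qed.

Lemma continuous_locint f : continuous f -> locint f.
Proof.
move=> cf t t0; apply: continuous_compact_integrable; first exact: segment_compact.
exact: continuous_subspaceT.
Qed.

Lemma locint_cst k : locint (fun=> k).
Proof. by apply: continuous_locint => x; exact: cvg_cst. Qed.

Lemma primitive_continuous f t : locint f -> 0 <= t ->
  {within `[0, t], continuous (fun r => itg 0 r f)}.
Proof. by move=> lf t0; apply: parameterized_integral_continuous => //; exact: lf. Qed.

Lemma locint_norm f : locint f -> locint (fun t => `|f t|).
Proof. by move=> lf t t0; apply: integrable_norm; exact: lf. Qed.

Lemma itg_norm f s t : locint f -> 0 <= s -> `|itg s t f| <= itg s t (fun t => `|f t|).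
Proof. by move=> lf s0; apply: le_normr_Rintegral => //; exact: locint_itv. Qed.

(** By compactness, [h] is bounded on each segment [0, t]. *)
Lemma locint_mul_continuous f h : locint f ->
  (forall t, 0 <= t -> {within `[0, t], continuous h}) ->
  locint (fun t => h t * f t).
Proof.
move=> lf ch t t0.
have ht := ch t t0.
have mh : measurable_fun `[0, t] h.
  by apply: subspace_continuous_measurable_fun.
have bh : [bounded h x | x in `[0, t]%classic].
  have /compact_bounded[M [_ mrt]] := continuous_compact ht (@segment_compact R 0 t).
  by exists M; split; rewrite ?num_real // => ? ? ? ?; exact: mrt.
have := @integrableMr _ _ _ mu `[0,t]%classic (measurable_itv _) h (EFin \o f) mh bh (lf t t0).
by apply: eq_integrable.
Qed.

(** Absolute continuity of the integral, uniform over the subintervals of [0, S]; extending [f] by 0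
    outside [0, S] gives a function integrable on the whole line. *)
Lemma itg_small f S e : locint f -> 0 <= S -> 0 < e ->
  exists2 d, 0 < d & forall s t, 0 <= s -> s <= t -> t <= S -> t - s < d ->
    itg s t (fun r => `|f r|) < e.
Proof.
move=> lf S0 e0; pose F := f \_ `[0, S].
have iF : mu.-integrable setT (EFin \o F).
  rewrite -restrict_EFin; apply/integrable_restrict => //=; rewrite setTI.
  exact: lf.
have [d [d0 hd]] := @integral_normr_continuous _ _ R mu F iF e e0.
exists d => // s t s0 st tS tsd.
have -> : itg s t (fun r => `|f r|) = itg s t (fun r => `|F r|).
  apply: eq_itg => r /andP[sr rt]; rewrite /F patchE ifT// inE/= in_itv/=.
  by rewrite (le_trans s0 sr) (le_trans rt tS).
apply: hd => //=; rewrite lebesgue_measure_itv/= lte_fin.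
by case: ifP => //=; rewrite ?lte_fin // -EFinD lte_fin.
Qed.

(** Induction on the number of steps of length [d / 2]: additivity carries a bound known on short
    intervals to long ones. Steps of half of [d] meet the strict condition on the length in the
    local bound. *)
Lemma additive_le_of_local (Phi G : R -> R -> R) (S d e : R) : 0 < d ->
  (forall s r t, 0 <= s -> s <= r -> r <= t -> t <= S ->
     Phi s t = Phi s r + Phi r t /\ G s t = G s r + G r t) ->
  (forall s t, 0 <= s -> s <= t -> t <= S -> t - s < d ->
     `|Phi s t| <= e * G s t) ->
  forall s t, 0 <= s -> s <= t -> t <= S -> `|Phi s t| <= e * G s t.
Proof.
move=> d0 addPhi loc s t s0 st tS.
have [N] : exists N : nat, t - s < N%:R * (d / 2).
  exists (Num.truncn ((t - s) / (d / 2))).+1.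
  by rewrite -ltr_pdivrMr ?divr_gt0//; exact: truncnS_gt.
elim: N s s0 st => [|N IH] s s0 st; first by rewrite mul0r subr_lt0 ltNge st.
move=> tsN.
have [sm|lg] := ltP (t - s) d; first exact: loc.
pose r := s + d / 2.
have sr : s <= r by rewrite /r; lra.
have rt : r <= t by rewrite /r; lra.
have [-> ->] := addPhi s r t s0 sr rt tS.
rewrite mulrDr (le_trans (ler_normD _ _))// lerD//.
  by apply: loc => //; rewrite /r; lra.
apply: IH => //; first lra.
by move: tsN; rewrite /r -natr1 mulrDl mul1r; lra.
Qed.

(* The primitive of an integrable f is only absolutely continuous, so no
   chain rule applies; on a short interval [u, v] the error is
   int (F u + F v - 2 F) f, with F u + F v - 2 F uniformly small. *)
Lemma primitive_sqr f s t : locint f -> 0 <= s -> s <= t ->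
  itg 0 t f ^+ 2 - itg 0 s f ^+ 2 = 2 * itg s t (fun r => itg 0 r f * f r).
Proof.
move=> lf s0 st; pose F r := itg 0 r f.
have lFf : locint (fun r => F r * f r).
  by apply: locint_mul_continuous => // r r0; exact: primitive_continuous.
have FB u v : 0 <= u -> u <= v -> F v - F u = itg u v f.
  by move=> u0 uv; rewrite /F (itg_additive lf (lexx 0) u0 uv) addrAC subrr add0r.
pose Phi u v := F v ^+ 2 - F u ^+ 2 - 2 * itg u v (fun r => F r * f r).
pose G u v := itg u v (fun r => `|f r|).
have t0 := le_trans s0 st.
(* As [e] is arbitrary, taking [e / (1 + G s t)] shows that [Phi s t] is 0; the 1 avoids a division
   by 0. *)
suff H : forall e, 0 < e -> `|Phi s t| <= e * G s t.
  apply/eqP; rewrite -subr_eq0 -normr_eq0 eq_le normr_ge0 andbT.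
  apply/ler_addgt0Pr => e e0; rewrite add0r.
  have G0 : 0 <= G s t by apply: itg_ge0 => r _.
  have := H (e / (1 + G s t)); rewrite divr_gt0 ?ltr_wpDr// => /(_ isT).
  move=> /le_trans; apply; rewrite mulrAC ler_pdivrMr ?ltr_wpDr//.
  by rewrite ler_pM2l// lerDr.
move=> e e0.
(* Half of [e] for each of the two differences [F v - F r] and [F r - F u]. *)
have [d d0 hd] := itg_small lf t0 (divr_gt0 e0 (ltr0Sn _ 1)).
apply: (@additive_le_of_local Phi G t d) => //.
  move=> u r v u0 ur rv vt; split.
    rewrite /Phi (itg_additive lFf u0 ur rv); ring.
  exact: itg_additive (locint_norm lf) u0 ur rv.
move=> u v u0 uv vt uvd.
have v0 := le_trans u0 uv.
have -> : Phi u v = itg u v (fun r => (F v + F u - 2 * F r) * f r).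
  have -> : itg u v (fun r => (F v + F u - 2 * F r) * f r) =
    itg u v (fun r => (F v + F u) * f r - 2 * (F r * f r)).
    by apply: eq_itg => r _; ring.
  rewrite itgB//; [|exact: locintZ|exact: locintZ].
  rewrite !itgZ// -FB// /Phi; ring.
have lX : locint (fun r => (F v + F u - 2 * F r) * f r).
  apply: (@eq_locint (fun r => (F v + F u) * f r - 2 * (F r * f r))).
    by move=> r _; ring.
  by apply: locintB; exact: locintZ.
apply: le_trans (itg_norm _ lX u0) _.
rewrite /G -itgZ//; last exact: locint_norm.
apply: itg_le => //; [exact: locint_norm|apply/locintZ/locint_norm => //|].
move=> r /andP[ur rv]; rewrite normrM ler_wpM2r//.
have r0 := le_trans u0 ur.
have -> : F v + F u - 2 * F r = (F v - F r) - (F r - F u) by ring.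
rewrite (FB _ _ r0 rv) (FB _ _ u0 ur); apply: le_trans (ler_normB _ _) _.
have rvd : v - r < d by apply: le_lt_trans uvd; rewrite lerD2l lerN2.
have urd : r - u < d by apply: le_lt_trans uvd; rewrite lerD2r.
rewrite [leRHS]splitr; apply: lerD; apply: ltW.
  exact: le_lt_trans (itg_norm v lf r0) (hd r v r0 rv vt rvd).
exact: le_lt_trans (itg_norm r lf u0) (hd u r u0 ur (le_trans rv vt) urd).
Qed.

End IntervalIntegral.

(** * Euclidean inner product and weighted inequalities *)

Definition dot {R : realType} {n : nat} (v w : 'cV[R]_n) : R := \sum_i v i 0 * w i 0.
Notation sqn v := (dot v v).

Section Dot.
Context {R : realType} {n : nat}.
Implicit Types (v w z : 'cV[R]_n) (k : R).

Lemma dotC v w : dot v w = dot w v.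
Proof. by apply: eq_bigr => i _; rewrite mulrC. Qed.

Lemma dotDl v w z : dot (v + w) z = dot v z + dot w z.
Proof. by rewrite -big_split; apply: eq_bigr => i _; rewrite mxE mulrDl. Qed.

Lemma dotZl k v w : dot (k *: v) w = k * dot v w.
Proof. by rewrite mulr_sumr; apply: eq_bigr => i _; rewrite mxE mulrA. Qed.

Lemma dotNl v w : dot (- v) w = - dot v w.
Proof. by rewrite -scaleN1r dotZl mulN1r. Qed.

Lemma sqn_ge0 v : 0 <= sqn v.
Proof. by apply: sumr_ge0 => i _; rewrite -expr2 sqr_ge0. Qed.

Lemma sqr_le_sqn v i : v i 0 ^+ 2 <= sqn v.
Proof.
rewrite /dot (bigD1 i)//= -expr2 lerDl.
by apply: sumr_ge0 => j _; rewrite -expr2 sqr_ge0.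
Qed.

(** The squared norm of [sqn w *: v - dot v w *: w] is [sqn w] times the difference of the two
    sides. *)
Lemma dot_cauchy v w : dot v w ^+ 2 <= sqn v * sqn w.
Proof.
have [w0|w0] := eqVneq (sqn w) 0.
  have wi i : w i 0 = 0.
    apply/eqP; rewrite -sqrf_eq0 eq_le sqr_ge0 andbT -w0; exact: sqr_le_sqn.
  rewrite w0 mulr0 /dot big1 ?expr0n// => i _; by rewrite wi mulr0.
have wp : 0 < sqn w by rewrite lt_neqAle eq_sym w0 sqn_ge0.
have := sqn_ge0 (sqn w *: v - dot v w *: w).
have -> : sqn (sqn w *: v - dot v w *: w) =
    sqn w * (sqn v * sqn w - dot v w ^+ 2).
  rewrite dotDl dotNl !dotZl !(dotC _ (_ - _)) !dotDl !dotNl !dotZl (dotC w v).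
  ring.
by rewrite pmulr_rge0// subr_ge0.
Qed.

Lemma dot_amgm k v w : 0 < k -> 2 * dot v w <= k * sqn v + k^-1 * sqn w.
Proof.
move=> k0; rewrite /dot !mulr_sumr -big_split/=; apply: ler_sum => i _.
rewrite -subr_ge0.
have -> : k * (v i 0 * v i 0) + k^-1 * (w i 0 * w i 0) - 2 * (v i 0 * w i 0) =
  k^-1 * (k * v i 0 - w i 0) ^+ 2.
  by field; rewrite gt_eqF.
by rewrite mulr_ge0 ?sqr_ge0 ?invr_ge0 ?ltW.
Qed.

End Dot.

Lemma amgm {R : realType} (k p q : R) : 0 < k -> 2 * (p * q) <= k * p ^+ 2 + k^-1 * q ^+ 2.
Proof.
move=> k0; rewrite -subr_ge0.
have -> : k * p ^+ 2 + k^-1 * q ^+ 2 - 2 * (p * q) = k^-1 * (k * p - q) ^+ 2.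
  by field; rewrite gt_eqF.
by rewrite mulr_ge0 ?sqr_ge0 ?invr_ge0 ?ltW.
Qed.

(** * Scalar form of the definitions *)

Section Bridge.
Context {R : realType} {n : nat}.
Local Notation mu := (@lebesgue_measure R).
Implicit Types (c u x : R -> 'cV[R]_n).

Lemma outerE (v : 'cV[R]_n) i j : (v *m v^T) i j = v i 0 * v j 0.
Proof. by rewrite mxE big_ord1 mxE. Qed.

Lemma outer_mulE (v w : 'cV[R]_n) i : (v *m v^T *m w) i 0 = v i 0 * dot v w.
Proof.
rewrite mxE mulr_sumr; apply: eq_bigr => j _; by rewrite outerE mulrA.
Qed.

Lemma rhsE (v w z : 'cV[R]_n) i :
  (- (v *m v^T *m w) + z) i 0 = - (v i 0 * dot v w) + z i 0.
Proof. by rewrite mxE [in X in X + _]mxE outer_mulE. Qed.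

(** The summands are grouped so as to isolate the products [w i 0 * w j 0]: for [w] = c(t) they are
    the entries of c c^T, whose local integrability is assumed. *)
Lemma sqr_dotE (v w : 'cV[R]_n) :
  dot v w ^+ 2 = \sum_i \sum_j v i 0 * (v j 0 * (w i 0 * w j 0)).
Proof.
rewrite expr2 /dot mulr_suml; apply: eq_bigr => i _.
rewrite mulr_sumr; apply: eq_bigr => j _; ring.
Qed.

Lemma quad_form_scalar (a : R) (v : 'cV[R]_n) : quad_form a%:M v = a * sqn v.
Proof.
rewrite /quad_form mul_mx_scalar -scalemxAl mxE; congr (_ * _).
by rewrite mxE; apply: eq_bigr => i _; rewrite mxE.
Qed.

Lemma locint_sqr_dot c (v : 'cV[R]_n) : (forall i j, locint (fun t => c t i 0 * c t j 0)) ->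
  locint (fun r => dot v (c r) ^+ 2).
Proof.
move=> lc; apply: (@eq_locint _ (fun r => \sum_i \sum_j v i 0 * (v j 0 * (c r i 0 * c r j 0)))).
  by move=> t _; rewrite sqr_dotE.
by do 2 (apply: locint_sum => ? _); do 2 apply: locintZ.
Qed.

Lemma quad_form_integral c (s t : R) (v : 'cV[R]_n) :
  (forall i j, locint (fun t => c t i 0 * c t j 0)) -> 0 <= s ->
  quad_form (mx_integral `[s, t] (fun r => c r *m (c r)^T)) v =
  itg s t (fun r => dot v (c r) ^+ 2).
Proof.
move=> lc s0.
rewrite (@eq_itg _ _ (fun r => \sum_i \sum_j v i 0 * (v j 0 * (c r i 0 * c r j 0)))); last first.
  by move=> r _; rewrite sqr_dotE.
rewrite itg_sum//; last first.
  by move=> i; apply: locint_sum => j _; do 2 apply: locintZ.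
rewrite /quad_form mxE.
under eq_bigr do rewrite mxE mulr_suml.
rewrite exchange_big/=; apply: eq_bigr => i _.
rewrite itg_sum//; last by move=> j; do 2 apply: locintZ.
apply: eq_bigr => j _.
rewrite itgZ//; last exact: locintZ.
rewrite itgZ// !mxE mulrAC mulrA; congr (_ * _).
by apply: eq_itg => r _; rewrite outerE.
Qed.

Lemma persistently_excitingP (a b T : R) c :
  persistently_exciting a b T c <->
  [/\ forall i, measurable_fun (`[0, +oo[ : set R) (fun t => c t i 0),
      forall i j, locint (fun t => c t i 0 * c t j 0) &
      forall t v, 0 <= t ->
        a * sqn v <= itg t (t + T) (fun r => dot v (c r) ^+ 2) <= b * sqn v].
Proof.
split=> [[mc lc H]|[mc lc H]].
  have lc' i j : locint (fun t => c t i 0 * c t j 0).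
    move=> t t0; apply: eq_integrable (lc t t0 i j) => // r _.
    by rewrite /= outerE.
  split=> // [t v t0].
  have [/(_ v) Ha /(_ v) Hb] := H t t0.
  rewrite !quad_form_scalar quad_form_integral// in Ha Hb.
  by rewrite Ha Hb.
split.
- by move=> i j; rewrite (ord1 j); exact: mc.
- move=> t t0 i j; apply: eq_integrable (lc i j t t0) => // r _.
  by rewrite /= outerE.
- move=> t t0; split => v; rewrite quad_form_scalar quad_form_integral//;
  by have /andP[] := H t v t0.
Qed.

Lemma is_solutionP c u x :
  is_solution c u x <->
  let f i r := - (c r i 0 * dot (c r) (x r)) + u r i 0 in
  (forall i, locint (f i)) /\ forall t i, 0 <= t -> x t i 0 = itg 0 t (f i).
Proof.
rewrite /is_solution.
split=> -[lf H]; split.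
- move=> i t t0; apply: eq_integrable (lf t t0 i 0) => // r _.
  by rewrite /= rhsE.
- move=> t i t0; rewrite {1}H// mxE; apply: eq_itg => r _.
  by rewrite rhsE.
- move=> t t0 i j; rewrite (ord1 j); apply: eq_integrable (lf i t t0) => // r _.
  by rewrite /= rhsE.
- move=> t t0; apply/colP => i; rewrite H// mxE.
  by apply: eq_itg => r _; rewrite rhsE.
Qed.

Lemma euclidean_normE (v : 'cV[R]_n) : euclidean_norm v = Num.sqrt (sqn v).
Proof. by congr Num.sqrt; apply: eq_bigr => i _; rewrite expr2. Qed.

Lemma L2normE u :
  L2norm u = ((\int[mu]_(t in `[0%R, +oo[) (sqn (u t))%:E) `^ 2^-1)%E.
Proof.
rewrite /L2norm unlock; congr (_ `^ _)%E.
rewrite [in RHS]integral_mkcond; apply: eq_integral => t _.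
rewrite /= !patchE; case: ifPn => _; last first.
  by rewrite abse0 poweR0r// pnatr_eq0.
rewrite /= euclidean_normE ger0_norm ?sqrtr_ge0// powR_mulrn ?sqrtr_ge0//.
by rewrite sqr_sqrtr// sqn_ge0.
Qed.

End Bridge.

(** * Upper bound *)

Section Trajectory.
Context {R : realType} {n : nat} (a b T : R) (c u x : R -> 'cV[R]_n).
Local Notation mu := (@lebesgue_measure R).
Local Notation y r := (dot (c r) (x r)).
Context (T0 : 0 < T) (a0 : 0 < a) (b0 : 0 < b)
  (lcc : forall i j, locint (fun t => c t i 0 * c t j 0))
  (PE : forall t v, 0 <= t ->
     a * sqn v <= itg t (t + T) (fun r => dot v (c r) ^+ 2) <= b * sqn v)
  (mu_u : forall i, measurable_fun (`[0, +oo[ : set R) (fun t => u t i 0))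
  (lu2 : locint (fun r => sqn (u r)))
  (lf : forall i, locint (fun r => - (c r i 0 * y r) + u r i 0))
  (xE : forall t i, 0 <= t ->
     x t i 0 = itg 0 t (fun r => - (c r i 0 * y r) + u r i 0)).

(** From |p| <= 1 + p^2, local square integrability gives local integrability. *)
Lemma locint_input i : locint (fun r => u r i 0).
Proof.
apply: (@locint_le _ _ (fun r => 1 + sqn (u r))) => //; last first.
  by apply: locintD => //; exact: locint_cst.
move=> t _; have := sqr_le_sqn (u t) i.
have := amgm `|u t i 0| 1 (@ltr01 R); rewrite invr1 expr1n !mulr1 mul1r real_normK ?num_real//.
have := sqr_ge0 (u t i 0); lra.
Qed.

Lemma state_continuous i t : 0 <= t -> {within `[0, t], continuous (fun r => x r i 0)}.
Proof.
move=> t0.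
apply: (@subspace_eq_continuous R `[0, t]%classic R
  (fun r => itg 0 r (fun r => - (c r i 0 * y r) + u r i 0))); last first.
  exact: primitive_continuous.
by move=> r; rewrite inE/= in_itv/= => /andP[r0 _]; exact/esym/xE.
Qed.

Lemma locint_state_mul i f : locint f -> locint (fun r => x r i 0 * f r).
Proof.
by move=> l; apply: locint_mul_continuous => // t; exact: state_continuous.
Qed.

(** Each summand is a continuous coordinate of the state times an entry of c c^T. *)
Lemma locint_gradient i : locint (fun r => c r i 0 * y r).
Proof.
apply: (@eq_locint _ (fun r => \sum_j x r j 0 * (c r i 0 * c r j 0))).
  by move=> t _; rewrite mulr_sumr; apply: eq_bigr => j _; ring.
by apply: locint_sum => j _; exact: locint_state_mul.
Qed.

Lemma locint_output : locint (fun r => y r ^+ 2).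
Proof.
apply: (@eq_locint _ (fun r => \sum_i x r i 0 * (c r i 0 * y r))).
  by move=> t _; rewrite expr2 {2}/dot mulr_suml; apply: eq_bigr => j _; ring.
apply: locint_sum => j _; apply: locint_state_mul; exact: locint_gradient.
Qed.

Lemma locint_state_input : locint (fun r => dot (x r) (u r)).
Proof. by apply: locint_sum => i _; apply/locint_state_mul/locint_input. Qed.

Lemma locint_state : locint (fun r => sqn (x r)).
Proof.
apply: locint_sum => i _; apply: locint_state_mul.
apply: (@eq_locint _ (fun r => x r i 0 * 1)); first by move=> t _; rewrite mulr1.
by apply: locint_state_mul; exact: locint_cst.
Qed.

(** [primitive_sqr] in each coordinate; the sum over i of x_i (- c_i y + u_i) is x . u - y^2. *)
Lemma energy s t : 0 <= s -> s <= t ->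
  sqn (x t) - sqn (x s) =
  2 * (itg s t (fun r => dot (x r) (u r)) - itg s t (fun r => y r ^+ 2)).
Proof.
move=> s0 st; have t0 := le_trans s0 st.
have lX i : locint (fun r => x r i 0 * (- (c r i 0 * y r) + u r i 0)).
  exact/locint_state_mul/lf.
rewrite -itgB//; [|exact: locint_state_input|exact: locint_output].
have -> : itg s t (fun r => dot (x r) (u r) - y r ^+ 2) =
    itg s t (fun r => \sum_i x r i 0 * (- (c r i 0 * y r) + u r i 0)).
  apply: eq_itg => r _; rewrite expr2 {2}/dot mulr_suml -sumrB.
  by apply: eq_bigr => i _; ring.
rewrite itg_sum// mulr_sumr -sumrB; apply: eq_bigr => i _.
rewrite -!expr2 !xE// (primitive_sqr (lf i) s0 st); congr (_ * _).
by apply: eq_itg => r /andP[sr _]; rewrite [in RHS]xE// (le_trans s0).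
Qed.

Lemma output_le t : 0 <= t ->
  itg 0 t (fun r => y r ^+ 2) <= itg 0 t (fun r => dot (x r) (u r)).
Proof.
move=> t0; have := energy (lexx 0) t0; have := sqn_ge0 (x t).
suff -> : sqn (x 0) = 0 by lra.
rewrite /dot big1// => i _.
by rewrite xE// set_itv1 Rintegral_set1 mul0r.
Qed.

Lemma state_growth s t : 0 <= s -> s <= t ->
  sqn (x t) <= sqn (x s) + 2 * itg s t (fun r => dot (x r) (u r)).
Proof.
move=> s0 st; have := energy s0 st.
have : 0 <= itg s t (fun r => y r ^+ 2) by apply: itg_ge0 => r _; exact: sqr_ge0.
lra.
Qed.

(** Duality: with w the integral of c y, |w|^2 is the integral of (w . c) y. AM-GM with weight 1/b,
    then the upper half of (PE) in the direction w, give 2 |w|^2 <= |w|^2 + b int y^2.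
    Cauchy-Schwarz with the trace of c c^T would give n b instead of b. *)
Lemma output_drift_le s t : 0 <= s -> s <= t -> t <= s + T ->
  sqn (\col_i itg s t (fun r => c r i 0 * y r)) <= b * itg s t (fun r => y r ^+ 2).
Proof.
move=> s0 st tT; set w : 'cV_n := \col_i _.
have lwc := locint_sqr_dot w lcc.
have lwcy : locint (fun r => dot w (c r) * y r).
  apply: (@eq_locint _ (fun r => \sum_i w i 0 * (c r i 0 * y r))).
    by move=> r _; rewrite [in RHS]mulr_suml; apply: eq_bigr => i _; ring.
  by apply: locint_sum => i _; apply/locintZ/locint_gradient.
have wE : sqn w = itg s t (fun r => dot w (c r) * y r).
  rewrite (@eq_itg _ _ (fun r => \sum_i w i 0 * (c r i 0 * y r))); last first.
    by move=> r _; rewrite mulr_suml; apply: eq_bigr => i _; ring.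
  rewrite itg_sum//; last by move=> i; apply/locintZ/locint_gradient.
  apply: eq_bigr => i _; rewrite itgZ//; last exact: locint_gradient.
  by rewrite [in X in _ * X]mxE.
have b'0 : 0 < b^-1 by rewrite invr_gt0.
have : 2 * itg s t (fun r => dot w (c r) * y r) <=
    b^-1 * itg s t (fun r => dot w (c r) ^+ 2) + b * itg s t (fun r => y r ^+ 2).
  have ly := locint_output.
  rewrite -!itgZ// -itgD//; [|exact: locintZ|exact: locintZ].
  apply: itg_le => //; [exact: locintZ|by apply: locintD; exact: locintZ|].
  by move=> r _; rewrite -{2}(invrK b); exact: amgm.
have : itg s t (fun r => dot w (c r) ^+ 2) <= b * sqn w.
  have /andP[_] := PE w s0; apply: le_trans.
  by apply: itg_nonincr_dom => // r _; exact: sqr_ge0.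
rewrite -(ler_pM2l b'0) mulrA mulVf ?gt_eqF// mul1r -wE; lra.
Qed.

(** The same duality, with weight 1/T and an interval of length at most [T]. *)
Lemma input_drift_le s t : 0 <= s -> s <= t -> t <= s + T ->
  sqn (\col_i itg s t (fun r => u r i 0)) <= T * itg s t (fun r => sqn (u r)).
Proof.
move=> s0 st tT; set w : 'cV_n := \col_i _.
have lwu : locint (fun r => dot w (u r)).
  by apply: locint_sum => i _; apply/locintZ/locint_input.
have wE : sqn w = itg s t (fun r => dot w (u r)).
  rewrite itg_sum//; last by move=> i; apply/locintZ/locint_input.
  apply: eq_bigr => i _; rewrite itgZ//; last exact: locint_input.
  by rewrite [in X in _ * X]mxE.
have T'0 : 0 < T^-1 by rewrite invr_gt0.
have : 2 * itg s t (fun r => dot w (u r)) <=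
    T^-1 * sqn w * (t - s) + T * itg s t (fun r => sqn (u r)).
  rewrite -itg_cst// -!itgZ// -itgD//; [|exact: locint_cst|exact: locintZ].
  apply: itg_le => //; [exact: locintZ|by apply: locintD; [exact: locint_cst|exact: locintZ]|].
  by move=> r _; rewrite -{2}(invrK T); exact: dot_amgm.
have : T^-1 * sqn w * (t - s) <= T^-1 * sqn w * T.
  rewrite ler_wpM2l//; first by rewrite mulr_ge0 ?sqn_ge0// ltW.
  by rewrite lerBlDl.
have -> : T^-1 * sqn w * T = sqn w by rewrite mulrAC mulVf ?gt_eqF// mul1r.
rewrite -wE; lra.
Qed.

Lemma displacementE s t : 0 <= s -> s <= t ->
  x t - x s = \col_i itg s t (fun r => u r i 0) - \col_i itg s t (fun r => c r i 0 * y r).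
Proof.
move=> s0 st; apply/colP => i; rewrite !mxE !xE ?(le_trans s0)//.
rewrite (itg_additive (lf i) (lexx 0) s0 st) addrAC subrr add0r.
rewrite -itgB//; [|exact: locint_input|exact: locint_gradient].
by apply: eq_itg => r _; rewrite addrC.
Qed.

Lemma locint_sqn_c : locint (fun r => sqn (c r)).
Proof. by apply: locint_sum => i _; exact: lcc. Qed.

(** (PE) in the n coordinate directions, summed. *)
Lemma trace_le s : 0 <= s -> itg s (s + T) (fun r => sqn (c r)) <= n%:R * b.
Proof.
move=> s0; rewrite itg_sum//.
rewrite mulr_natl -[in X in _ *+ X](card_ord n) -sumr_const; apply: ler_sum => i _.
have /andP[_] := PE (delta_mx i 0) s0.
have dE (v : 'cV[R]_n) : dot (delta_mx i 0) v = v i 0.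
  rewrite /dot (bigD1 i)//= big1 ?addr0; first by rewrite mxE !eqxx mul1r.
  by move=> j ji; rewrite mxE (negbTE ji) mul0r.
rewrite dE mxE !eqxx mulr1; apply: le_trans.
by rewrite le_eqVlt; apply/orP; left; apply/eqP/eq_itg => r _; rewrite dE expr2.
Qed.

(* x s . c = y + w . c - z . c, with w and z the drifts of the two lemmas above. *)
Lemma observability s : 0 <= s ->
  a * sqn (x s) <= 3 * (1 + n%:R * b ^+ 2) * itg s (s + T) (fun r => y r ^+ 2)
    + 3 * n%:R * b * T * itg s (s + T) (fun r => sqn (u r)).
Proof.
move=> s0; have sT : s <= s + T by rewrite lerDl ltW.
set Y := itg s _ (fun r => y r ^+ 2); set U := itg s _ (fun r => sqn (u r)).
have Y0 : 0 <= Y by apply: itg_ge0 => r _; exact: sqr_ge0.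
have U0 : 0 <= U by apply: itg_ge0 => r _; exact: sqn_ge0.
have /andP[+ _] := PE (x s) s0 => /le_trans; apply.
have lc2 := locint_sqn_c; have ly := locint_output.
(* [b * Y] and [T * U] bound |w|^2 and |z|^2 throughout the window; 3 comes from (p + q - k)^2 <= 3
   (p^2 + q^2 + k^2). *)
pose C := 3 * (b * Y + T * U).
apply: (@le_trans _ _ (itg s (s + T) (fun r => 3 * y r ^+ 2 + C * sqn (c r)))).
  apply: itg_le => //; [exact: locint_sqr_dot|by apply: locintD; exact: locintZ|].
  move=> r /andP[sr rT].
  have := displacementE s0 sr.
  have := output_drift_le s0 sr rT; have := input_drift_le s0 sr rT.
  set z : 'cV_n := \col_i _; set w : 'cV_n := \col_i _ => hz hw xr.
  have hYr : itg s r (fun r => y r ^+ 2) <= Y.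
    by apply: itg_nonincr_dom => // ? _; exact: sqr_ge0.
  have hUr : itg s r (fun r => sqn (u r)) <= U.
    by apply: itg_nonincr_dom => // ? _; exact: sqn_ge0.
  have hw' : sqn w <= b * Y by rewrite (le_trans hw)// ler_pM2l.
  have hz' : sqn z <= T * U by rewrite (le_trans hz)// ler_pM2l.
  have -> : dot (x s) (c r) = y r + dot w (c r) - dot z (c r).
    have -> : x s = x r + w - z by rewrite -[in x r](subrK (x s) (x r)) xr; apply/colP => i; rewrite !mxE; ring.
    by rewrite !dotDl dotNl (dotC (x r)).
  have h1 : dot w (c r) ^+ 2 <= b * Y * sqn (c r).
    by rewrite (le_trans (dot_cauchy _ _))// ler_wpM2r ?sqn_ge0.
  have h2 : dot z (c r) ^+ 2 <= T * U * sqn (c r).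
    by rewrite (le_trans (dot_cauchy _ _))// ler_wpM2r ?sqn_ge0.
  move: h1 h2; rewrite /C.
  move: (y r) (dot w _) (dot z _) => p q k.
  (* These three squares add up to 3 (p^2 + q^2 + k^2) - (p + q - k)^2. *)
  have := sqr_ge0 (p - q); have := sqr_ge0 (p + k); have := sqr_ge0 (q + k).
  nra.
rewrite itgD//; [|exact: locintZ|exact: locintZ].
rewrite !itgZ// -/Y.
have C0 : 0 <= C by rewrite /C !(mulr_ge0, addr_ge0)// ltW.
have := ler_wpM2l C0 (trace_le s0); rewrite /C expr2; lra.
Qed.

(** On the window |x(t)|^2 exceeds |x(s)|^2 by at most 2 int x . u, which AM-GM with weight [e]
    splits; integrating in t costs a factor [T], and [observability] bounds a |x(s)|^2. The weight
    is chosen in [state_le]. *)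
Lemma state_window e s : 0 <= s -> 0 < e ->
  a * itg s (s + T) (fun r => sqn (x r)) <=
    3 * T * (1 + n%:R * b ^+ 2) * itg s (s + T) (fun r => y r ^+ 2)
    + (3 * n%:R * b * T ^+ 2 + a * T * e^-1) * itg s (s + T) (fun r => sqn (u r))
    + a * T * e * itg s (s + T) (fun r => sqn (x r)).
Proof.
move=> s0 e0; have sT : s <= s + T by rewrite lerDl ltW.
have lx := locint_state; have lxu := locint_state_input.
set X := itg s _ (fun r => sqn (x r)); set U := itg s _ (fun r => sqn (u r)).
have : X <= itg s (s + T) (fun=> sqn (x s) + (e * X + e^-1 * U)).
  apply: itg_le => //; first exact: locint_cst.
  move=> t /andP[st tT]; apply: (le_trans (state_growth s0 st)).
  rewrite lerD2l -itgZ//.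
  have l2 : locint (fun r => e * sqn (x r) + e^-1 * sqn (u r)).
    by apply: locintD; exact: locintZ.
  apply: (@le_trans _ _ (itg s t (fun r => e * sqn (x r) + e^-1 * sqn (u r)))).
    apply: itg_le => //; first exact: locintZ.
    by move=> r _; exact: dot_amgm.
  apply: (@le_trans _ _ (itg s (s + T) (fun r => e * sqn (x r) + e^-1 * sqn (u r)))).
    by apply: itg_nonincr_dom => // r _; rewrite addr_ge0// mulr_ge0 ?sqn_ge0 ?invr_ge0 ?ltW.
  by rewrite itgD//; [rewrite !itgZ|exact: locintZ|exact: locintZ].
rewrite itg_cst// (addrC s) addrK.
move=> h1; have := ler_wpM2l (ltW a0) h1.
have := ler_wpM2l (ltW T0) (observability s0); rewrite -/U (addrC s).
rewrite expr2 [in T ^+ 2]expr2; lra.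
Qed.

Lemma state_windows e N : 0 < e ->
  a * itg 0 (N%:R * T) (fun r => sqn (x r)) <=
    3 * T * (1 + n%:R * b ^+ 2) * itg 0 (N%:R * T) (fun r => y r ^+ 2)
    + (3 * n%:R * b * T ^+ 2 + a * T * e^-1) * itg 0 (N%:R * T) (fun r => sqn (u r))
    + a * T * e * itg 0 (N%:R * T) (fun r => sqn (x r)).
Proof.
move=> e0; elim: N => [|N IH].
  by rewrite mul0r set_itv1 !Rintegral_set1 !mulr0 !addr0.
have NT : 0 <= N%:R * T by rewrite mulr_ge0// ltW.
have NT' : N%:R * T <= N.+1%:R * T by rewrite ler_pM2r// ler_nat.
rewrite (itg_additive locint_state (lexx 0) NT NT').
rewrite (itg_additive locint_output (lexx 0) NT NT').
rewrite (itg_additive lu2 (lexx 0) NT NT').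
have := state_window NT e0.
have -> : N%:R * T + T = N.+1%:R * T by rewrite -natr1 mulrDl mul1r.
move: IH; lra.
Qed.

Lemma state_le N : a <= b -> (1 <= n)%N ->
  itg 0 (N%:R * T) (fun r => sqn (x r)) <=
  (5 * (T * (1 + n%:R * b ^+ 2) / a)) ^+ 2 * itg 0 (N%:R * T) (fun r => sqn (u r)).
Proof.
move=> ab n1.
have NT : 0 <= N%:R * T by rewrite mulr_ge0// ltW.
set D := 1 + n%:R * b ^+ 2; set K := T * D / a.
have n1R : 1 <= n%:R :> R by rewrite ler1n.
have D0 : 0 < D by rewrite /D ltr_wpDr// mulr_ge0// sqr_ge0.
have K0 : 0 < K by rewrite /K divr_gt0// mulr_gt0.
(* With this weight [K * e] is 1/4, so the terms in [X] on the right, 2 a K e X in total, amount to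
   half of a X. What remains is X <= 22 K^2 U, and 22 <= 5^2. *)
pose e := (4 * K)^-1.
have e0 : 0 < e by rewrite /e invr_gt0 mulr_gt0.
set X := itg 0 _ (fun r => sqn (x r)); set U := itg 0 _ (fun r => sqn (u r)).
have U0 : 0 <= U by apply: itg_ge0 => r _; exact: sqn_ge0.
have X0 : 0 <= X by apply: itg_ge0 => r _; exact: sqn_ge0.
have hW := state_windows N e0; rewrite -/X -/U -/D in hW.
have hY := output_le NT.
have hXU : 2 * itg 0 (N%:R * T) (fun r => dot (x r) (u r)) <= e * X + e^-1 * U.
  have lx := locint_state; have lxu := locint_state_input.
  rewrite -!itgZ// -itgD//; [|exact: locintZ|exact: locintZ].
  apply: itg_le => //; [exact: locintZ|by apply: locintD; exact: locintZ|].
  by move=> r _; exact: dot_amgm.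
have TE : a * K = T * D by rewrite /K mulrC divfK// gt_eqF.
have b2 : 2 * a <= D.
  by rewrite /D; have := sqr_ge0 (b - 1); have : b ^+ 2 <= n%:R * b ^+ 2
    by [rewrite ler_peMl// sqr_ge0]; rewrite !expr2; lra.
(* This and [nbK] replace the lower-order coefficients of [hW] by powers of [K]. *)
have TK : 2 * T <= K.
  by rewrite -(ler_pM2l a0) TE; have := ler_wpM2l (ltW T0) b2; lra.
have nbK : n%:R * b * T ^+ 2 <= a * K ^+ 2.
  rewrite -(ler_pM2l a0) [leRHS](_ : _ = (T * D) ^+ 2); last by rewrite -TE; ring.
  rewrite exprMn; have h : a * (n%:R * b) <= D ^+ 2.
    have : a * (n%:R * b) <= n%:R * b ^+ 2.
      by rewrite expr2 mulrCA ler_wpM2l// ler_wpM2r// ltW.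
    have : D <= D ^+ 2.
      by rewrite expr2 ler_peMl ?(ltW D0)// /D lerDl mulr_ge0// sqr_ge0.
    rewrite /D; lra.
  have := ler_wpM2l (sqr_ge0 T) h; lra.
have hY2 : 2 * itg 0 (N%:R * T) (fun r => y r ^+ 2) <= e * X + e^-1 * U by lra.
have TD0 : 0 < T * D by rewrite mulr_gt0.
have P0 : 0 <= e * X + e^-1 * U.
  by have e0' := ltW e0; rewrite addr_ge0// mulr_ge0// invr_ge0.
have eK : K * e = 1/4 by rewrite /e; field; rewrite gt_eqF.
have eV : e^-1 = 4 * K by rewrite /e invrK.
have h1 := ler_wpM2l (ltW TD0) hY2.
have h2 := ler_wpM2r U0 nbK.
have h3 := ler_wpM2r P0 TK.
have h4 := ler_wpM2l (ltW a0) h3.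
rewrite -(ler_pM2l a0).
have H : a * X <= 2 * (a * K) * (e * X + e^-1 * U) + 3 * (a * K ^+ 2 * U).
  rewrite TE; move: h4; rewrite (mulrA a K) TE; move: hW h1 h2; lra.
have E1 : 2 * (a * K) * (e * X + e^-1 * U) = a * X / 2 + 8 * (a * K ^+ 2 * U).
  rewrite eV [LHS](_ : _ = 2 * a * X * (K * e) + 8 * (a * K ^+ 2 * U)); last ring.
  by rewrite eK; field.
have aKU : 0 <= a * K ^+ 2 * U by rewrite mulr_ge0// mulr_ge0 ?sqr_ge0// ltW.
rewrite E1 in H; rewrite exprMn; lra.
Qed.

End Trajectory.

(** * From finite horizons to the gain *)

Section UpperBound.
Context {R : realType} {n : nat}.
Local Notation mu := (@lebesgue_measure R).
Implicit Types (c u x v : R -> 'cV[R]_n).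

Lemma measurable_sqn D v : (forall i, measurable_fun D (fun t => v t i 0)) ->
  measurable_fun D (fun t => sqn (v t)).
Proof.
move=> mv; rewrite (_ : (fun t => sqn (v t)) = (fun t => \sum_i v t i 0 * v t i 0))//.
by apply: measurable_sum => i; exact: measurable_funM.
Qed.

Lemma sqr_L2norm_ge0 v : (0 <= \int[mu]_(t in `[0%R, +oo[) (sqn (v t))%:E)%E.
Proof. by apply: integral_ge0 => t _; rewrite lee_fin sqn_ge0. Qed.

Lemma in_L2_integrable v : in_L2 v ->
  mu.-integrable `[0, +oo[ (EFin \o (fun t => sqn (v t))).
Proof.
move=> [mv]; rewrite L2normE => /lty_poweRy; rewrite invr_neq0// => /(_ isT) V.
apply/integrableP; split.
  by apply/measurable_EFinP; apply: measurable_sqn => i; exact: mv.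
under eq_integral do rewrite gee0_abs ?lee_fin ?sqn_ge0//.
exact: V.
Qed.

(** Monotone convergence along the segments [0, N T]. *)
Lemma integral_halfline_le v (B : \bar R) (T : R) : 0 < T ->
  (forall i, measurable_fun (`[0, +oo[ : set R) (fun t => v t i 0)) ->
  (forall N : nat, (\int[mu]_(t in `[0%R, (N%:R * T)%R]) (sqn (v t))%:E <= B)%E) ->
  (\int[mu]_(t in `[0%R, +oo[) (sqn (v t))%:E <= B)%E.
Proof.
move=> T0 mv H.
have -> : (`[0, +oo[%classic : set R) = \bigcup_N (`[0, N%:R * T : R]%classic).
  apply/seteqP; split => [x /=|x [k _]] /=; rewrite !in_itv/= ?andbT.
    move=> x0; exists (Num.truncn (x / T)).+1 => //=; rewrite in_itv/= x0/=.
    by rewrite -ler_pdivrMr//; apply/ltW/truncnS_gt.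
  by move=> /andP[].
have h : (fun N : nat => (\int[mu]_(t in `[0%R, (N%:R * T)%R]) (sqn (v t))%:E)%E) @ \oo -->
   (\int[mu]_(t in \bigcup_N (`[0%R, (N%:R * T : R)%R]%classic)) (sqn (v t))%:E)%E.
  have HH := (@ge0_nondecreasing_set_cvg_integral _ (measurableTypeR R) R
    (fun N : nat => `[0, N%:R * T]%classic) (fun t => (sqn (v t))%:E) lebesgue_measure).
  apply: HH => //.
  - move=> p q pq; apply/subsetPset; apply: subset_itvl.
    by rewrite bnd_simp ler_pM2r// ler_nat.
  - move=> i; apply/measurable_EFinP; apply: measurable_funS (measurable_sqn mv) => //.
    by move=> x /=; rewrite !in_itv/= => /andP[->].
  - by move=> i x _; rewrite lee_fin sqn_ge0.
by apply: (cvge_to_le h); near=> N; exact: H.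
Unshelve. all: by end_near. Qed.

(** Serves both bounds; for the lower one the roles of input and state are exchanged. *)
Lemma L2norm_le_of_integral u x (K : R) : 0 <= K ->
  (\int[mu]_(t in `[0%R, +oo[) (sqn (x t))%:E <=
    (K ^+ 2)%:E * \int[mu]_(t in `[0%R, +oo[) (sqn (u t))%:E)%E ->
  (L2norm x <= K%:E * L2norm u)%E.
Proof.
move=> K0 h; rewrite !L2normE.
have -> : K%:E = ((K ^+ 2)%:E `^ 2^-1)%E.
  by rewrite poweR_EFin powR12_sqrt ?sqr_ge0// sqrtr_sqr ger0_norm.
rewrite -poweRM ?sqr_L2norm_ge0// ?lee_fin ?sqr_ge0//.
apply: gt0_ler_poweR => //; rewrite ?invr_ge0// in_itv/= ?andbT leey andbT.
  exact: sqr_L2norm_ge0.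
by rewrite mule_ge0 ?sqr_L2norm_ge0// lee_fin sqr_ge0.
Qed.

Lemma L2gain_le (a b T : R) c : 0 < a -> a <= b -> 0 < T -> (1 <= n)%N ->
  persistently_exciting a b T c ->
  (L2gain c <= (5 * (T * (1 + n%:R * b ^+ 2) / a))%:E)%E.
Proof.
move=> a0 ab T0 n1 /persistently_excitingP[mc lcc PE].
set K := 5 * _.
have b0 := lt_le_trans a0 ab.
have K0 : 0 <= K.
  rewrite /K mulr_ge0// divr_ge0 ?(ltW a0)// mulr_ge0 ?(ltW T0)// addr_ge0//.
  by rewrite mulr_ge0// sqr_ge0.
apply: ge_ereal_sup => _ [u [x [uL2 u0 /is_solutionP[lf xE] ->]]].
have iu := in_L2_integrable uL2.
have lu2 : locint (fun r => sqn (u r)).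
  move=> t t0; apply: integrableS iu => //.
  by move=> r /=; rewrite !in_itv/= => /andP[->].
have mu_u i : measurable_fun (`[0, +oo[ : set R) (fun t => u t i 0) by exact: uL2.1.
have lx := locint_state lf xE.
have mx i : measurable_fun (`[0, +oo[ : set R) (fun t => x t i 0).
  apply: locint_measurable.
  apply: (@eq_locint _ (fun r => x r i 0 * 1)); first by move=> t _; rewrite mulr1.
  by apply: (locint_state_mul lf xE); exact: locint_cst.
have h : (\int[mu]_(t in `[0%R, +oo[) (sqn (x t))%:E <=
    (K ^+ 2)%:E * \int[mu]_(t in `[0%R, +oo[) (sqn (u t))%:E)%E.
  apply: (integral_halfline_le T0) => // N.
  have NT : 0 <= N%:R * T by rewrite mulr_ge0// ltW.
  apply: (@le_trans _ _ ((K ^+ 2)%:E *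
     \int[mu]_(t in `[0%R, (N%:R * T)%R]) (sqn (u t))%:E)%E).
    rewrite -[leLHS]fineK; last exact: integrable_fin_num (lx _ NT).
    rewrite -[X in (_ * X)%E]fineK; last exact: integrable_fin_num (lu2 _ NT).
    rewrite -EFinM lee_fin.
    exact: (state_le T0 a0 b0 lcc PE mu_u lu2 lf xE N ab n1).
  apply: lee_wpmul2l; first by rewrite lee_fin sqr_ge0.
  apply: ge0_subset_integral => //.
  - by apply/measurable_EFinP; apply: measurable_sqn.
  - by move=> t _; rewrite lee_fin sqn_ge0.
  - by move=> t /=; rewrite !in_itv/= => /andP[->].
have := L2norm_le_of_integral K0 h.
(* [L2norm u] is a positive real, so the quotient of extended reals is an ordinary one. *)
have := uL2.2; move: u0; have : (0 <= L2norm u)%E by exact: Lnorm_ge0.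
case: (L2norm u) => [r|//|//]; rewrite lee_fin eqe => r0 rn0 _.
have rp : 0 < r by rewrite lt_neqAle eq_sym rn0.
by rewrite inver (negbTE rn0) lee_pdivrMr.
Qed.

End UpperBound.

(** * Lower bound *)

Section HalfLineCalculus.
Context {R : realType}.
Local Notation mu := (@lebesgue_measure R).
Implicit Types (f g F : R -> R) (s t r : R).

(** Continuity is two-sided at every point, 0 included, which is what differentiability there
    provides; nothing is asked at negative arguments. *)
Definition hcont f := forall t, 0 <= t -> {for t, continuous f}.

Lemma hcont_within f s t : hcont f -> 0 <= s -> {within `[s, t], continuous f}.
Proof.
move=> cf s0; apply: continuous_in_subspaceT => r; rewrite inE/= in_itv/=.
by move=> /andP[sr _]; apply: cf; exact: le_trans sr.
Qed.

Lemma hcont_locint f : hcont f -> locint f.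
Proof.
move=> cf t t0; apply: continuous_compact_integrable; first exact: segment_compact.
exact: hcont_within.
Qed.

Lemma hcontD f g : hcont f -> hcont g -> hcont (fun t => f t + g t).
Proof. by move=> cf cg t t0; apply: cvgD; [exact: cf|exact: cg]. Qed.

Lemma hcontN f : hcont f -> hcont (fun t => - f t).
Proof. by move=> cf t t0; apply: cvgN; exact: cf. Qed.

Lemma hcontM f g : hcont f -> hcont g -> hcont (fun t => f t * g t).
Proof. by move=> cf cg t t0; apply: cvgM; [exact: cf|exact: cg]. Qed.

Lemma hcontX f k : hcont f -> hcont (fun t => f t ^+ k).
Proof.
move=> cf; elim: k => [|k IH]; first by move=> t t0; exact: cvg_cst.
rewrite (_ : (fun t => _) = (fun t => f t * f t ^+ k)); first exact: hcontM.
by apply/funext => t; rewrite exprS.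
Qed.

Lemma hcont_cst k : hcont (fun=> k).
Proof. by move=> t t0; exact: cvg_cst. Qed.

Lemma hcont_sum n (F : 'I_n -> R -> R) : (forall i, hcont (F i)) ->
  hcont (fun t => \sum_i F i t).
Proof.
move=> cF; rewrite -fct_sumE.
by elim/big_ind : _ => // [|f g]; [exact: hcont_cst|exact: hcontD].
Qed.

Lemma continuous_hcont f : continuous f -> hcont f.
Proof. by move=> cf t _; exact: cf. Qed.

Lemma hcont_comp f g : hcont f -> continuous g -> hcont (fun t => g (f t)).
Proof. by move=> cf cg t t0; apply: continuous_comp; [exact: cf|exact: cg]. Qed.

Lemma itg_derive F f s t : (forall r, 0 <= r -> is_derive r 1 F (f r)) -> hcont f ->
  0 <= s -> s <= t -> itg s t f = F t - F s.
Proof.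
move=> dF cf s0; rewrite le_eqVlt => /predU1P[<-|st].
  by rewrite set_itv1 Rintegral_set1 subrr.
have cF r : 0 <= r -> {for r, continuous F}.
  move=> r0; apply: differentiable_continuous; apply/derivable1_diffP.
  by have [] := dF r r0.
rewrite /Rintegral (@continuous_FTC2 R f F)//.
- exact: hcont_within.
- split.
  + move=> r; rewrite in_itv/= => /andP[sr _].
    by have [] := dF r (le_trans s0 (ltW sr)).
  + by apply: cvg_at_right_filter; exact: cF.
  + by apply: cvg_at_left_filter; apply: cF; rewrite (le_trans s0)// ltW.
- move=> r; rewrite in_itv/= => /andP[sr _].
  by rewrite derive1E; have [] := dF r (le_trans s0 (ltW sr)).
Qed.

(* The lower limit -1 makes the primitive differentiable at 0. *)
Definition prim g t := itg (-1) t g.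

Lemma is_derive_prim g t : continuous g -> 0 <= t -> is_derive t 1 (prim g) (g t).
Proof.
move=> cg t0.
have ig : mu.-integrable `[-1, t + 1] (EFin \o g).
  apply: continuous_compact_integrable; first exact: segment_compact.
  exact: continuous_subspaceT.
have tt : t < t + 1 by rewrite ltrDl.
have t1 : -1 < t by apply: lt_le_trans t0; rewrite oppr_lt0.
have [d <-] := continuous_FTC1_closed tt ig t1 (cg t).
by rewrite derive1E; exact: derivableP.
Qed.

Lemma prim_itg g s t : continuous g -> 0 <= s -> s <= t ->
  itg s t g = prim g t - prim g s.
Proof.
move=> cg s0 st; apply: itg_derive => //; first by move=> r; exact: is_derive_prim.
exact: continuous_hcont.
Qed.

Lemma itg_translate g s t k : continuous g -> s <= t ->
  itg (s + k) (t + k) g = itg s t (fun r => g (r + k)).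
Proof.
move=> cg; rewrite le_eqVlt => /predU1P[<-|st].
  by rewrite !set_itv1 !Rintegral_set1.
rewrite /Rintegral.
have F1 r : is_derive r 1 (fun r : R => r + k) (1 : R).
  by have := @is_deriveD _ _ _ id (cst k) r 1 1 0 _ _; rewrite addr0; apply.
have F1E : derive1 (fun r : R => r + k) = cst 1.
  by apply/funext => r; rewrite derive1E; have [] := F1 r.
have cF : continuous (fun r : R => r + k).
  by move=> r; apply: cvgD; [exact: cvg_id|exact: cvg_cst].
have -> := @integration_by_substitution_increasing R (fun r => r + k) g s t (ltW st).
- by congr fine; apply: eq_integral => r _; rewrite F1E/= mulr1.
- by move=> p q _ _; rewrite ltrD2r.
- by rewrite F1E => r _; exact: cvg_cst.
- by rewrite F1E; apply/cvg_ex; exists 1; exact: cvg_cst.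
- by rewrite F1E; apply/cvg_ex; exists 1; exact: cvg_cst.
- split; first by move=> r _; have [] := F1 r.
  + by apply: cvg_at_right_filter; exact: cF.
  + by apply: cvg_at_left_filter; exact: cF.
- exact: continuous_subspaceT.
Qed.

(** The segment [0, t + T] is split at t and at [T]; the piece [T, t + T] is a translate of
    [0, t]. *)
Lemma itg_period g T t : continuous g -> 0 < T -> (forall r, g (r + T) = g r) ->
  0 <= t -> itg t (t + T) g = itg 0 T g.
Proof.
move=> cg T0 gT t0; have lg := continuous_locint cg.
have tT : t <= t + T by rewrite lerDl ltW.
have T0' := ltW T0.
have h1 := itg_additive lg (lexx 0) t0 tT.
have h2 := @itg_additive _ g 0 T (t + T) lg (lexx 0) T0' _.
have := itg_translate T cg t0; rewrite add0r.
rewrite (@eq_itg _ (fun r => g (r + T)) g)// => h3.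
have := h2 ltac:(by rewrite lerDr); rewrite h3 h1; lra.
Qed.

(** Just to the right of [t0], [f] stays above half of [f t0], so [t0] may be the left endpoint but
    not the right one. *)
Lemma itg_gt0 f s t t0 : hcont f -> 0 <= s -> s <= t0 < t -> 0 < f t0 ->
  (forall r, 0 <= r -> 0 <= f r) -> 0 < itg s t f.
Proof.
move=> cf s0 /andP[st0 t0t] f0 fge; have lf := hcont_locint cf.
have t00 := le_trans s0 st0.
have : \forall r \near t0, f t0 / 2 < f r.
  by apply: (cvgr_gt _ (cf t0 t00)); lra.
move=> [d /= d0 hd].
pose r := Num.min t (t0 + d / 2).
have t0r : t0 < r by rewrite lt_min t0t ltrDl divr_gt0.
have rt : r <= t by rewrite ge_min lexx.
have rd : r <= t0 + d / 2 by rewrite ge_min lexx orbT.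
rewrite (itg_additive lf s0 st0 (ltW t0t)) (itg_additive lf t00 (ltW t0r) rt).
have h1 : 0 <= itg s t0 f by apply: itg_ge0 => q /andP[sq _]; exact/fge/(le_trans s0).
have h2 : 0 <= itg r t f.
  by apply: itg_ge0 => q /andP[sq _]; apply/fge/(le_trans _ sq)/(le_trans t00)/ltW.
suff : 0 < itg t0 r f by lra.
apply: (@lt_le_trans _ _ (itg t0 r (fun=> f t0 / 2))).
  by rewrite itg_cst ?(ltW t0r)// mulr_gt0 ?divr_gt0// subr_gt0.
apply: itg_le => //; first exact: locint_cst.
move=> q /andP[t0q qr]; apply/ltW/hd; rewrite /ball_/= distrC ger0_norm ?subr_ge0//.
by rewrite ltrBlDl (le_lt_trans qr)// (le_lt_trans rd)// ltrD2l ltr_pdivrMr// ltr_pMr// ltr1n.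
Qed.

(** The horizon is rounded up to the next multiple of [T], whence the extra 1. *)
Lemma itg_period_le g T t : continuous g -> 0 < T -> (forall r, g (r + T) = g r) ->
  (forall r, 0 <= g r) -> itg 0 T g = 1 -> 0 <= t -> itg 0 t g <= t / T + 1.
Proof.
move=> cg T0 gT g0 g1 t0; have lg := continuous_locint cg.
have E (N : nat) : itg 0 (N%:R * T) g = N%:R.
  elim: N => [|N IH]; first by rewrite mul0r set_itv1 Rintegral_set1.
  have NT : 0 <= N%:R * T by rewrite mulr_ge0// ltW.
  rewrite -natr1 mulrDl mul1r (itg_additive lg (lexx 0) NT); last by rewrite lerDl ltW.
  by rewrite IH itg_period// g1.
have tT : 0 <= t / T by rewrite divr_ge0// ltW.
have /andP[h1 h2] := truncn_itv tT.
apply: (@le_trans _ _ (itg 0 ((Num.truncn (t / T)).+1%:R * T) g)).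
  by apply: itg_nonincr_dom => //; rewrite -ler_pdivrMr// ltW.
by rewrite E -natr1 lerD2r.
Qed.

End HalfLineCalculus.

(** * Derivatives of explicit expressions *)

Section PointwiseDerivatives.
Context {R : realType}.
Implicit Types (f g : R -> R) (t df dg k : R).

Lemma is_derive_add f g t df dg : is_derive t 1 f df -> is_derive t 1 g dg ->
  is_derive t 1 (fun r => f r + g r) (df + dg).
Proof. by move=> Hf Hg; exact: is_deriveD. Qed.

Lemma is_derive_mul f g t df dg : is_derive t 1 f df -> is_derive t 1 g dg ->
  is_derive t 1 (fun r => f r * g r) (df * g t + f t * dg).
Proof.
move=> Hf Hg; apply: (is_derive_eq (is_deriveM Hf Hg)).
by rewrite addrC; congr (_ + _); rewrite mulrC.
Qed.

Lemma is_derive_scale k f t df : is_derive t 1 f df ->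
  is_derive t 1 (fun r => k * f r) (k * df).
Proof. by move=> Hf; exact: is_deriveZ. Qed.

Lemma is_derive_chain f g t df dg : is_derive t 1 f df -> is_derive (f t) 1 g dg ->
  is_derive t 1 (fun r => g (f r)) (dg * df).
Proof. by move=> Hf Hg; exact: is_derive1_comp. Qed.

(** Squaring removes the kink of the positive part: at 0 the difference quotient at step h is at
    most |h| in absolute value. *)
Lemma is_derive_sqr_pos_part t :
  is_derive t 1 (fun z => Num.max 0 z ^+ 2) (2 * Num.max 0 t).
Proof.
have [t0|t0|->] := ltgtP t 0.
- apply: (@near_eq_is_derive _ _ _ (cst 0)).
  + near=> z; rewrite /cst/= max_l ?expr0n//.
    by apply/ltW; near: z; exact: (lt_nbhsl t0).
  + by rewrite mulr0; exact: is_derive_cst.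
- apply: (@near_eq_is_derive R R R (fun z : R => z * z)).
  + near=> z; rewrite /= max_r ?expr2//.
    by apply/ltW; near: z; exact: (lt_nbhsr t0).
  + apply: (is_derive_eq (is_derive_mul (is_derive_id t 1) (is_derive_id t 1))).
    ring.
- rewrite mulr0.
  pose q h : R := h^-1 *: (((fun z : R => Num.max 0 z ^+ 2) \o shift 0) (h *: 1) - Num.max 0 0 ^+ 2).
  have H : q h @[h --> 0^'] --> (0 : R).
    apply/cvgrPdist_le => e e0; near=> h.
    rewrite sub0r normrN /q /= maxxx expr0n subr0 addr0 [h *: 1]mulr1.
    have h0 : h != 0 by near: h; exact: nbhs_dnbhs_neq.
    have he : `|h| <= e.
      near: h; apply: nbhs_dnbhs; apply/nbhs_ballP; exists e => //= z.
      by rewrite /ball/= sub0r normrN => /ltW.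
    rewrite [_ *: _]/(_ * _) normrM normfV ler_pdivrMl ?normr_gt0//.
    have m : `|Num.max 0 h| <= `|h|.
      by case: (leP 0 h) => // _; rewrite normr0.
    by rewrite expr2 normrM ler_pM// (le_trans m).
  by apply: DeriveDef; [apply/cvg_ex; exists 0|exact: cvg_lim].
Unshelve. all: by end_near. Qed.

End PointwiseDerivatives.

(** * Gain forced by a slowly decaying homogeneous solution *)

Section GainLowerBound.
Context {R : realType} {n : nat}.
Local Notation mu := (@lebesgue_measure R).
Implicit Types (c u x v xi : R -> 'cV[R]_n) (M delta k s t : R) (F f : R -> R).

Lemma hcont_sqn v : (forall i, hcont (fun t => v t i 0)) -> hcont (fun t => sqn (v t)).
Proof. by move=> cv; apply: hcont_sum => i; exact: hcontM. Qed.

Lemma sqnZ k (v : 'cV[R]_n) : sqn (k *: v) = k ^+ 2 * sqn v.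
Proof. by rewrite dotZl dotC dotZl mulrA expr2. Qed.

Lemma itg_sqn_le_halfline v s t : (forall i, hcont (fun t => v t i 0)) -> 0 <= s ->
  ((itg s t (fun r => sqn (v r)))%:E <= \int[mu]_(t in `[0%R, +oo[) (sqn (v t))%:E)%E.
Proof.
move=> cv s0; have lv := hcont_locint (hcont_sqn cv).
rewrite /Rintegral fineK; last exact: integrable_fin_num (locint_itv _ lv s0).
apply: ge0_subset_integral => //.
- by apply/measurable_EFinP; apply: locint_measurable.
- by move=> r _; rewrite lee_fin sqn_ge0.
- by move=> r /=; rewrite !in_itv/= andbT => /andP[sr _]; exact: le_trans sr.
Qed.

(** This is phi of the test pair; its positive part is squared so that phi is differentiable at [M]
    too, and the equation holds on the whole half-line. *)
Lemma is_derive_cutoff M t :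
  is_derive t 1 (fun r : R => r * Num.max 0 (M - r) ^+ 2)
    (Num.max 0 (M - t) ^+ 2 - 2 * t * Num.max 0 (M - t)).
Proof.
have d1 : is_derive t 1 (fun r : R => M - r) (-1).
  have := is_derive_add (is_derive_cst M t 1) (is_derive_scale (-1) (is_derive_id t 1)).
  rewrite add0r mulr1; apply: near_eq_is_derive; near=> z.
  by rewrite /cst/= mulN1r.
have d2 := is_derive_chain d1 (is_derive_sqr_pos_part (M - t)).
apply: (is_derive_eq (is_derive_mul (is_derive_id t 1) d2)).
rewrite mul1r; ring.
Unshelve. all: by end_near. Qed.

Lemma continuous_pos_part M : continuous (fun r : R => Num.max 0 (M - r)).
Proof.
move=> r; apply: (@continuous_max R R (cst 0) (fun r => M - r)).
  exact: cvg_cst.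
by apply: cvgB; [exact: cvg_cst|exact: cvg_id].
Qed.

Lemma hcont_derive F f : (forall t, 0 <= t -> is_derive t 1 F (f t)) -> hcont (F : R -> R).
Proof.
move=> dF t t0; apply: differentiable_continuous; apply/derivable1_diffP.
by have [] := dF t t0.
Qed.

(* The test pair is x = phi xi with phi t = t (M - t)_+^2, for which
   u = x' + c c^T x reduces to phi' xi. *)
Lemma L2gain_ge c xi M delta :
  (forall i, hcont (fun t => c t i 0)) ->
  (forall i t, 0 <= t ->
    is_derive t 1 (fun r => xi r i 0) (- (c t i 0 * dot (c t) (xi t)))) ->
  0 < M -> 0 < delta ->
  (forall t, 0 <= t <= M -> delta ^+ 2 <= sqn (xi t) <= 1) ->
  ((delta * M / 64)%:E <= L2gain c)%E.
Proof.
move=> cc dxi M0 d0 bxi.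
pose m (r : R) := Num.max 0 (M - r); pose phi (r : R) := r * m r ^+ 2.
pose psi (r : R) := m r ^+ 2 - 2 * r * m r.
pose x (r : R) : 'cV[R]_n := phi r *: xi r; pose u (r : R) : 'cV[R]_n := psi r *: xi r.
have cm : hcont m by apply: continuous_hcont; exact: continuous_pos_part.
have cid : hcont (fun r : R => r) by move=> r _; exact: cvg_id.
have cphi : hcont phi by apply: hcontM => //; exact: hcontX.
have cpsi : hcont psi.
  apply: hcontD; first exact: hcontX.
  by apply/hcontN/hcontM => //; apply: hcontM => //; exact: hcont_cst.
have cxi i : hcont (fun r => xi r i 0) by exact: hcont_derive (dxi i).
have xE (r : R) i : x r i 0 = phi r * xi r i 0 by rewrite mxE.
have uE r i : u r i 0 = psi r * xi r i 0 by rewrite mxE.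
have cx i : hcont (fun r => x r i 0).
  by rewrite (_ : (fun r => _) = (fun r => phi r * xi r i 0));
    [exact: hcontM|apply/funext => r; exact: xE].
have cu i : hcont (fun r => u r i 0).
  by rewrite (_ : (fun r => _) = (fun r => psi r * xi r i 0));
    [exact: hcontM|apply/funext => r; exact: uE].
have sol : is_solution c u x.
  apply/is_solutionP => /=.
  have cf i : hcont (fun r => - (c r i 0 * dot (c r) (x r)) + u r i 0).
    apply: hcontD => //; apply/hcontN/hcontM => //.
    by apply: hcont_sum => j; exact: hcontM.
  split=> [i|t i t0]; first exact: hcont_locint.
  have df (r : R) : 0 <= r -> is_derive r 1 (fun r => phi r * xi r i 0)
      (- (c r i 0 * dot (c r) (x r)) + u r i 0).
    move=> r0; apply: (is_derive_eq (is_derive_mul (is_derive_cutoff M r) (dxi i r r0))).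
    rewrite uE (dotC (c r) (x r)) dotZl (dotC (xi r)) /phi /psi /m.
    ring.
  rewrite (itg_derive df (cf i) (lexx 0) t0).
  by rewrite xE /phi !mul0r subr0.
have mE r : r <= M -> m r = M - r by move=> rM; rewrite /m max_r// subr_ge0.
have mu_u i : measurable_fun (`[0, +oo[ : set R) (fun t => u t i 0).
  by apply: locint_measurable; exact: hcont_locint.
have lu2 := hcont_locint (hcont_sqn cu).
(* On [0, M], |psi| <= 2 M^2 and |xi| <= 1, so |u|^2 <= 4 M^4; beyond [M] the input vanishes. *)
have IuB : (\int[mu]_(t in `[0%R, +oo[) (sqn (u t))%:E <= (4 * M ^+ 5)%:E)%E.
  apply: (integral_halfline_le (@ltr01 R)) => // N; rewrite mulr1.
  have N0 : 0 <= N%:R :> R by [].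
  rewrite -[leLHS]fineK; last exact: integrable_fin_num (lu2 _ N0).
  rewrite lee_fin -/(itg 0 N%:R (fun t => sqn (u t))).
  have H t : 0 <= t -> t <= M -> itg 0 t (fun t => sqn (u t)) <= 4 * M ^+ 5.
    move=> t0 tM; apply: (@le_trans _ _ (4 * M ^+ 4 * t)).
      rewrite -[in leRHS](subr0 t) -itg_cst//.
      apply: itg_le => //; first exact: locint_cst.
      move=> r /andP[r0 rt]; have rM := le_trans rt tM.
      have /andP[_ x1] : delta ^+ 2 <= sqn (xi r) <= 1 by apply: bxi; rewrite r0.
      rewrite sqnZ -[leRHS]mulr1 ler_pM ?sqr_ge0 ?sqn_ge0//.
      have -> : 4 * M ^+ 4 = (2 * M ^+ 2) ^+ 2 by ring.
      have M2 : 0 <= 2 * M ^+ 2 by apply: mulr_ge0 => //; exact: sqr_ge0.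
      rewrite -[leLHS]real_normK ?num_real// ler_pXn2r ?nnegrE//.
      by rewrite /psi mE// ler_norml; apply/andP; split; nra.
    have M4 : 0 <= 4 * M ^+ 4 by rewrite mulr_ge0// exprn_ge0// ltW.
    have -> : 4 * M ^+ 5 = 4 * M ^+ 4 * M by ring.
    by rewrite ler_wpM2l.
  have [NM|MN] := leP N%:R M; first exact: H.
  rewrite (itg_additive lu2 (lexx 0) (ltW M0) (ltW MN)).
  rewrite (@eq_itg _ (fun t => sqn (u t)) (fun=> 0) M); last first.
    move=> r /andP[Mr _]; rewrite sqnZ /psi /m max_l ?subr_le0//.
    by rewrite expr0n mulr0 subrr expr0n mul0r.
  rewrite itg_cst ?(ltW MN)// mul0r addr0; exact: H (ltW M0) (lexx M).
(* On [M/4, M/2], phi is at least (M/4) (M/2)^2 = M^3/16 and |xi| at least [delta]; the segment has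
   length M/4. *)
have IxA : ((delta ^+ 2 * M ^+ 7 / 1024)%:E <=
    \int[mu]_(t in `[0%R, +oo[) (sqn (x t))%:E)%E.
  have M4 : 0 <= M / 4 by rewrite divr_ge0// ltW.
  apply: le_trans (itg_sqn_le_halfline (M / 2) cx M4); rewrite lee_fin.
  apply: (@le_trans _ _ (itg (M / 4) (M / 2) (fun=> delta ^+ 2 * M ^+ 6 / 256))).
    rewrite itg_cst; last lra.
    rewrite le_eqVlt; apply/orP; left; apply/eqP; by field.
  apply: itg_le => //; [exact: locint_cst|by apply: hcont_locint; exact: hcont_sqn|].
  move=> r /andP[r4 r2].
  have /andP[x1 _] : delta ^+ 2 <= sqn (xi r) <= 1 by apply: bxi; lra.
  rewrite sqnZ.
  have -> : delta ^+ 2 * M ^+ 6 / 256 = (M ^+ 3 / 16) ^+ 2 * delta ^+ 2 by field.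
  have ph : M ^+ 3 / 16 <= phi r.
    rewrite /phi mE; last lra.
    have -> : M ^+ 3 / 16 = M / 4 * (M / 2) ^+ 2 by field.
    rewrite ler_pM ?exprn_ge0//; first lra.
    by rewrite ler_pXn2r// ?nnegrE; lra.
  have M3 : 0 <= M ^+ 3 / 16 by rewrite divr_ge0// exprn_ge0// ltW.
  rewrite ler_pM ?sqr_ge0//.
  by rewrite ler_pXn2r// nnegrE (le_trans M3).
(* The input is nonzero at time 0, where psi is M^2. *)
have Iu0 : (0 < \int[mu]_(t in `[0%R, +oo[) (sqn (u t))%:E)%E.
  apply: lt_le_trans (itg_sqn_le_halfline M cu (lexx 0)); rewrite lte_fin.
  apply: (@itg_gt0 _ _ 0 M 0) => //; first exact: hcont_sqn.
  - by rewrite lexx.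
  - rewrite sqnZ /psi mE ?(ltW M0)// subr0 mulr0 mul0r subr0.
    have /andP[x1 _] : delta ^+ 2 <= sqn (xi 0) <= 1 by apply: bxi; rewrite lexx ltW.
    by rewrite mulr_gt0 ?exprn_gt0// (lt_le_trans _ x1)// exprn_gt0.
  - by move=> r _; exact: sqn_ge0.
(* K^2 is the quotient of the two bounds, 4 M^5 and delta^2 M^7 / 1024. *)
pose K := 64 / (delta * M).
have K0 : 0 < K by rewrite divr_gt0// mulr_gt0.
have hK : (L2norm u <= K%:E * L2norm x)%E.
  apply: L2norm_le_of_integral; first exact: ltW.
  apply: (le_trans IuB).
  have -> : 4 * M ^+ 5 = K ^+ 2 * (delta ^+ 2 * M ^+ 7 / 1024).
    by rewrite /K; field; rewrite !gt_eqF.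
  by rewrite EFinM lee_wpmul2l// lee_fin sqr_ge0.
have uL2 : in_L2 u.
  split; first by move=> i j; rewrite (ord1 j).
  by rewrite L2normE poweR_lty// (le_lt_trans IuB)// ltry.
have u0 : L2norm u != 0%E.
  by rewrite L2normE poweR_eq0 ?sqr_L2norm_ge0// negb_and gt_eqF.
apply: le_ereal_sup_tmp; exists (L2norm x / L2norm u)%E; first by exists u, x; split.
have KV : delta * M / 64 = K^-1 by rewrite /K invf_div.
rewrite KV.
have := uL2.2; move: u0 hK; have : (0 <= L2norm u)%E by exact: Lnorm_ge0.
case: (L2norm u) => [r|//|//]; rewrite lee_fin eqe => r0 rn0 hK _.
have rp : 0 < r by rewrite lt_neqAle eq_sym rn0.
rewrite inver (negbTE rn0) lee_pdivlMr//.
have := lee_wpmul2l _ hK; move=> /(_ K^-1%:E); rewrite lee_fin invr_ge0 => /(_ (ltW K0)).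
by rewrite muleA -(EFinM K^-1 K) mulVf ?gt_eqF// mul1e.
Qed.

End GainLowerBound.

(** * Periodic functions with disjoint supports *)

Section Bumps.
Context {R : realType}.
Implicit Types (T t : R).

Lemma continuous_sqr (f : R -> R) : continuous f -> continuous (fun r => f r ^+ 2).
Proof.
move=> cf r; apply: (@continuous_comp _ _ _ f (fun z => z ^+ 2)); first exact: cf.
exact: exprn_continuous.
Qed.

(** Tents of half-width 1/2 around the integers k < n, composed with n cos (2 pi r / T): periodicity
    comes from the cosine, disjointness from the distance between distinct integers, and the
    normalization divides by the square root of [J k]. *)
Lemma periodic_bumps n T : 0 < T -> exists g : 'I_n -> R -> R,
  [/\ forall k, continuous (g k), forall k r, g k (r + T) = g k r,
      forall j k r, j != k -> g j r * g k r = 0 &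
      forall k, itg 0 T (fun r => g k r ^+ 2) = 1].
Proof.
move=> T0; pose w := pi *+ 2 / T.
have w0 : 0 < w by rewrite divr_gt0// mulrn_wgt0// pi_gt0.
pose f (k : 'I_n) (r : R) := Num.max 0 (2^-1 - `|n%:R * cos (w * r) - k%:R|).
have cf k : continuous (f k).
  move=> r; apply: (@continuous_max R R (cst 0)
    (fun r => 2^-1 - `|n%:R * cos (w * r) - k%:R|)); first exact: cvg_cst.
  apply: cvgB; first exact: cvg_cst.
  apply: cvg_norm; apply: cvgB; last exact: cvg_cst.
  apply: cvgM; first exact: cvg_cst.
  apply: continuous_comp; last exact: continuous_cos.
  by apply: cvgM; [exact: cvg_cst|exact: cvg_id].
have fT k r : f k (r + T) = f k r.
  by rewrite /f mulrDr (_ : w * T = pi *+ 2) ?cosD2pi// /w divfK// gt_eqF.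
have f0 k r : 0 <= f k r by rewrite /f le_max lexx.
have fD j k r : j != k -> f j r * f k r = 0.
  move=> jk; rewrite /f; set y := n%:R * _.
  have [hj|hj] := leP 2^-1 `|y - j%:R|.
    by rewrite [X in X * _]max_l ?mul0r// subr_le0.
  have [hk|hk] := leP 2^-1 `|y - k%:R|.
    by rewrite [X in _ * X]max_l ?mulr0// subr_le0.
  have jk1 : `|j%:R - k%:R : R| < 1.
    have -> : j%:R - k%:R = (y - k%:R) - (y - j%:R) :> R by ring.
    by apply: le_lt_trans (ler_normB _ _) _; lra.
  case/eqP: jk; apply/val_inj => /=.
  case: (ltngtP j k) => // jk; move: jk; rewrite -(ler_nat R) -natr1 => jk;
  exfalso; move: jk1; rewrite ltr_norml => /andP[]; lra.
pose J k := itg 0 T (fun r => f k r ^+ 2).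
have cf2 k : continuous (fun r => f k r ^+ 2).
  by exact: continuous_sqr.
have J0 k : 0 < J k.
  have n0 : 0 < n%:R :> R by rewrite ltr0n (leq_ltn_trans _ (ltn_ord k)).
  (* The tent of index k reaches its top where the cosine is k / n, a value in [0, 1[. *)
  pose z : R := k%:R / n%:R.
  have z0 : 0 <= z by rewrite divr_ge0.
  have z1 : z < 1 by rewrite ltr_pdivrMr// mul1r ltr_nat.
  have zI : -1 <= z <= 1 by lra.
  pose t0 := acos z / w.
  have wt0 : w * t0 = acos z by rewrite /t0 mulrC divfK// gt_eqF.
  apply: (@itg_gt0 _ _ 0 T t0) => //.
  - by apply: continuous_hcont; exact: cf2.
  - rewrite divr_ge0 ?acos_ge0 ?(ltW w0)//= /t0 ltr_pdivrMr//.
    rewrite /w mulrC divfK ?gt_eqF// (le_lt_trans (acos_lepi zI))//.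
    by rewrite mulr2n ltrDl pi_gt0.
  - rewrite /f wt0 acosK; last by rewrite in_itv/=.
    rewrite /z mulrC divfK ?gt_eqF// subrr normr0 subr0 exprn_gt0//.
  - by move=> r _; exact: sqr_ge0.
exists (fun k r => (Num.sqrt (J k))^-1 * f k r); split.
- by move=> k r; apply: cvgM; [exact: cvg_cst|exact: cf].
- by move=> k r; rewrite fT.
- by move=> j k r jk; rewrite mulrACA fD// mulr0.
- move=> k; rewrite (@eq_itg _ _ (fun r => (J k)^-1 * f k r ^+ 2)).
    by rewrite itgZ ?mulVf ?gt_eqF//; exact: continuous_locint.
  by move=> r _; rewrite exprMn exprVn sqr_sqrtr// ltW.
Qed.

End Bumps.

(** * Decoupled components, for bounded [b] *)

Section SlowDirection.
Context {R : realType}.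
Implicit Types (a b T : R).

(** With disjoint bumps scaled by the square root of [a], the integral in (PE) is exactly [a] times
    the identity. A solution starting on the first axis stays there and decays like exp (- a sigma),
    where sigma grows by 1 per period. *)
Lemma L2gain_decoupled n a b T : 0 < a -> a <= b -> 0 < T ->
  exists2 c : R -> 'cV[R]_n.+1, persistently_exciting a b T c &
    ((expR (- (1 + a)) * (T / a) / 64)%:E <= L2gain c)%E.
Proof.
move=> a0 ab T0.
have [g [cg gT gD g1]] := periodic_bumps n.+1 T0.
pose c (r : R) : 'cV[R]_n.+1 := \col_i (Num.sqrt a * g i r).
have cE r i : c r i 0 = Num.sqrt a * g i r by rewrite mxE.
have sa : Num.sqrt a * Num.sqrt a = a by rewrite -expr2 sqr_sqrtr// ltW.
have cc i : hcont (fun r => c r i 0).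
  apply: continuous_hcont => r.
  rewrite (_ : (fun r => c r i 0) = (fun r => Num.sqrt a * g i r)).
    by apply: cvgM; [exact: cvg_cst|exact: cg].
  by apply/funext => ?; exact: cE.
have cg2 i : continuous (fun r => g i r ^+ 2).
  by exact: continuous_sqr.
have gT2 i r : g i (r + T) ^+ 2 = g i r ^+ 2 by rewrite gT.
exists c.
  apply/persistently_excitingP; split.
  - by move=> i; apply: locint_measurable; exact: hcont_locint.
  - by move=> i j; apply/hcont_locint/hcontM.
  - move=> t v t0.
    suff -> : itg t (t + T) (fun r => dot v (c r) ^+ 2) = a * sqn v.
      by rewrite lexx ler_wpM2r ?sqn_ge0.
    rewrite (@eq_itg _ _ (fun r => \sum_i (a * v i 0 ^+ 2) * g i r ^+ 2)); last first.
      move=> r _; rewrite sqr_dotE; apply: eq_bigr => i _.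
      rewrite (bigD1 i)//= big1 ?addr0; first by
        rewrite !cE [LHS](_ : _ = (Num.sqrt a * Num.sqrt a) * v i 0 ^+ 2 * g i r ^+ 2); [rewrite sa|ring].
      move=> j ji; rewrite !cE [X in _ * (_ * X)]mulrACA gD 1?eq_sym//.
      by rewrite !mulr0.
    rewrite itg_sum//; last by move=> i; apply/locintZ/continuous_locint.
    rewrite mulr_sumr; apply: eq_bigr => i _.
    rewrite itgZ//; last exact: continuous_locint.
    by rewrite itg_period// g1 mulr1 expr2.
pose h r := g ord0 r ^+ 2.
pose sigma r := prim h r - prim h 0.
have dsigma (r : R) : 0 <= r -> is_derive r 1 sigma (h r).
  move=> r0; have := is_derive_add (is_derive_prim (cg2 ord0) r0) (is_derive_cst (- prim h 0) r 1).
  by rewrite addr0.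
have sigmaE (r : R) : 0 <= r -> sigma r = itg 0 r h by move=> r0; rewrite prim_itg//; exact: cg2.
have sigma_le (r : R) : 0 <= r -> 0 <= sigma r <= r / T + 1.
  move=> r0; rewrite sigmaE//; apply/andP; split.
    by apply: itg_ge0 => q _; exact: sqr_ge0.
  exact: itg_period_le (cg2 ord0) T0 (gT2 ord0) (fun q => sqr_ge0 _) (g1 ord0) r0.
pose xi (r : R) : 'cV[R]_n.+1 := \col_i ((i == ord0)%:R * expR (- a * sigma r)).
have xiE r i : xi r i 0 = (i == ord0)%:R * expR (- a * sigma r) by rewrite mxE.
have cxi r : dot (c r) (xi r) = c r ord0 0 * expR (- a * sigma r).
  rewrite /dot (bigD1 ord0)//= big1 ?addr0; first by rewrite xiE eqxx mul1r.
  by move=> j j0; rewrite xiE (negbTE j0) mul0r mulr0.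
have xi2 r : sqn (xi r) = expR (- a * sigma r) ^+ 2.
  rewrite /dot (bigD1 ord0)//= big1 ?addr0; first by rewrite xiE eqxx mul1r expr2.
  by move=> j j0; rewrite xiE (negbTE j0) mul0r mulr0.
(* Up to time T / a, sigma is at most 1/a + 1, so the exponent a sigma is at most 1 + a. *)
apply: (@L2gain_ge _ _ c xi (T / a) (expR (- (1 + a)))) => //.
- move=> i t t0; rewrite (_ : (fun r => xi r i 0) =
    (fun r => (i == ord0)%:R * expR (- a * sigma r))); last by apply/funext => ?; exact: xiE.
  apply: (is_derive_eq (is_derive_scale _ (is_derive_chain (is_derive_scale (- a) (dsigma t t0))
    (is_derive_expR _)))).
  rewrite cxi !cE /h.
  have [->|i0] := eqVneq i ord0.
    rewrite mul1r [RHS](_ : _ = - (Num.sqrt a * Num.sqrt a) * g ord0 t ^+ 2 * expR (- a * sigma t)).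
      by rewrite sa; ring.
    by ring.
  rewrite mul0r.
  by rewrite [X in - X](_ : _ = Num.sqrt a * Num.sqrt a * expR (- a * sigma t) * (g i t * g ord0 t));
    [rewrite gD// mulr0 oppr0|ring].
- by rewrite divr_gt0.
- exact: expR_gt0.
- move=> t /andP[t0 tM]; rewrite xi2.
  have /andP[s0 s1] := sigma_le t t0.
  have tT : t / T <= a^-1 by rewrite ler_pdivrMr// mulrC.
  have as1 : a * sigma t <= 1 + a.
    have <- : a * (a^-1 + 1) = 1 + a by rewrite mulrDr mulfV ?gt_eqF// mulr1.
    by rewrite ler_pM2l// (le_trans s1)// lerD2r.
  apply/andP; split.
    by rewrite ler_pXn2r ?nnegrE ?expR_ge0// ler_expR mulNr lerN2.
  by rewrite exprn_ile1 ?expR_ge0// -expR0 ler_expR mulNr oppr_le0 mulr_ge0// ltW.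
Qed.

End SlowDirection.

(** * A line turning at constant speed in its internal time *)

Section RotatingLine.
Context {R : realType}.
Implicit Types (w s S t : R).

(** A primitive in s of (v0 cos (w s) + v1 sin (w s))^2: the excitation received by the direction
    (v0, v1) up to the internal time s. *)
Definition rot_mass w (v0 v1 : R) s : R :=
  (v0 ^+ 2 + v1 ^+ 2) / 2 * s +
  (2 * w)^-1 * ((v0 ^+ 2 - v1 ^+ 2) * (sin (w * s) * cos (w * s)) +
    2 * v0 * v1 * (sin (w * s) * sin (w * s))).

Lemma is_derive_sin_scale w s : is_derive s 1 (fun r : R => sin (w * r)) (w * cos (w * s)).
Proof.
apply: (is_derive_eq (is_derive_chain (is_derive_scale w (is_derive_id s 1)) (is_derive_sin _))).
by rewrite mulr1 mulrC.
Qed.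

Lemma is_derive_cos_scale w s : is_derive s 1 (fun r : R => cos (w * r)) (- (w * sin (w * s))).
Proof.
apply: (is_derive_eq (is_derive_chain (is_derive_scale w (is_derive_id s 1)) (is_derive_cos _))).
by rewrite mulr1 mulrC mulrN.
Qed.

Lemma is_derive_rot_mass w (v0 v1 : R) s : w != 0 ->
  is_derive s 1 (rot_mass w v0 v1) ((v0 * cos (w * s) + v1 * sin (w * s)) ^+ 2).
Proof.
move=> w0.
have ds := is_derive_sin_scale w s; have dc := is_derive_cos_scale w s.
apply: (is_derive_eq (is_derive_add
  (is_derive_scale ((v0 ^+ 2 + v1 ^+ 2) / 2) (is_derive_id s 1))
  (is_derive_scale (2 * w)^-1 (is_derive_add
    (is_derive_scale (v0 ^+ 2 - v1 ^+ 2) (is_derive_mul ds dc))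
    (is_derive_scale (2 * v0 * v1) (is_derive_mul ds ds)))))).
set co := cos (w * s); set si := sin (w * s).
have e1 : 1 = co ^+ 2 + si ^+ 2 by rewrite cos2Dsin2.
transitivity ((v0 ^+ 2 + v1 ^+ 2) / 2 * (co ^+ 2 + si ^+ 2) +
  ((v0 ^+ 2 - v1 ^+ 2) / 2 * (co ^+ 2 - si ^+ 2) + 2 * v0 * v1 * si * co)).
  by rewrite -e1; field.
by field.
Qed.

(** Over an internal time [S] the Gram matrix of the turning line has eigenvalues S/2 plus or minus
    |sin (w S)| / (2 w). Product formulas factor sin (w S) out of the oscillating part, and
    Cauchy-Schwarz bounds the rest. *)
Lemma rot_mass_shift w (v0 v1 : R) s S : 0 < w ->
  `|rot_mass w v0 v1 (s + S) - rot_mass w v0 v1 s - (v0 ^+ 2 + v1 ^+ 2) * (S / 2)| <=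
  (v0 ^+ 2 + v1 ^+ 2) * (`|sin (w * S)| / (2 * w)).
Proof.
move=> w0; have w0' : w != 0 by rewrite gt_eqF.
set p := w * s; set p' := w * (s + S).
have -> : w * S = p' - p by rewrite /p /p'; ring.
rewrite sinB.
have e1 := cos2Dsin2 p; have e2 := cos2Dsin2 p'.
(* [C], [D] and [E] are cos (p + p'), sin (p + p') and sin (p' - p). *)
pose C := cos p * cos p' - sin p * sin p'; pose D := sin p * cos p' + cos p * sin p'.
pose E := sin p' * cos p - cos p' * sin p.
have h1 : sin p' * cos p' - sin p * cos p = C * E.
  rewrite [LHS](_ : _ = sin p' * cos p' * (cos p ^+ 2 + sin p ^+ 2) -
    sin p * cos p * (cos p' ^+ 2 + sin p' ^+ 2)); last by rewrite e1 e2; ring.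
  by rewrite /C /E; ring.
have h2 : sin p' * sin p' - sin p * sin p = D * E.
  rewrite [LHS](_ : _ = sin p' * sin p' * (cos p ^+ 2 + sin p ^+ 2) -
    sin p * sin p * (cos p' ^+ 2 + sin p' ^+ 2)); last by rewrite e1 e2; ring.
  by rewrite /D /E; ring.
have h3 : C ^+ 2 + D ^+ 2 = 1.
  by rewrite [LHS](_ : _ = (cos p ^+ 2 + sin p ^+ 2) * (cos p' ^+ 2 + sin p' ^+ 2));
    [rewrite e1 e2 mulr1|rewrite /C /D; ring].
have -> : rot_mass w v0 v1 (s + S) - rot_mass w v0 v1 s - (v0 ^+ 2 + v1 ^+ 2) * (S / 2) =
   ((v0 ^+ 2 - v1 ^+ 2) * C + 2 * v0 * v1 * D) * (E / (2 * w)).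
  rewrite [RHS](_ : _ = (2 * w)^-1 * ((v0 ^+ 2 - v1 ^+ 2) * (C * E) + 2 * v0 * v1 * (D * E))); last by field.
  rewrite -h1 -h2 /rot_mass -/p -/p'; by field.
rewrite normrM normf_div [`|2 * w|]gtr0_norm ?mulr_gt0//.
rewrite ler_wpM2r ?divr_ge0 ?(ltW (mulr_gt0 _ w0))//.
have V0 : 0 <= v0 ^+ 2 + v1 ^+ 2 by rewrite addr_ge0// sqr_ge0.
rewrite -ler_sqr ?nnegrE// real_normK ?num_real//.
have -> : (v0 ^+ 2 + v1 ^+ 2) ^+ 2 = (v0 ^+ 2 + v1 ^+ 2) ^+ 2 * (C ^+ 2 + D ^+ 2).
  by rewrite h3 mulr1.
rewrite -subr_ge0.
(* The vectors (v0^2 - v1^2, 2 v0 v1) and (C, D) have norms v0^2 + v1^2 and 1; the square is the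
   defect in Cauchy-Schwarz. *)
rewrite [X in 0 <= X](_ : _ = ((v0 ^+ 2 - v1 ^+ 2) * D - 2 * v0 * v1 * C) ^+ 2); last by ring.
exact: sqr_ge0.
Qed.

Lemma big_ord_recl2 m (F : 'I_m.+2 -> R) :
  \sum_i F i = F ord0 + F (lift ord0 ord0) + \sum_k F (lift ord0 (lift ord0 k)).
Proof. by rewrite !big_ord_recl addrA. Qed.

Lemma sqr_sum_orthogonal m (F : 'I_m -> R) : (forall j k, j != k -> F j * F k = 0) ->
  (\sum_k F k) ^+ 2 = \sum_k F k ^+ 2.
Proof.
move=> FD; rewrite expr2 mulr_suml; apply: eq_bigr => k _.
rewrite mulr_sumr (bigD1 k)//= big1 ?addr0 ?expr2// => j jk.
by rewrite FD// eq_sym.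
Qed.

(* In the time sigma and in the frame turning with the line, the homogeneous
   system has constant coefficients, with slow eigenvalue - p^2 and eigenvector
   (p, q) when the line turns at speed p q. *)
Lemma L2gain_rotating m (a b T S p q M kappa : R) :
  0 < a -> a <= b -> 0 < T -> 0 < S -> 0 < p -> 0 < q -> p ^+ 2 + q ^+ 2 = 1 ->
  a <= S / 2 - `|sin (p * q * S)| / (2 * (p * q)) ->
  S / 2 + `|sin (p * q * S)| / (2 * (p * q)) <= b ->
  0 < M -> p ^+ 2 * (S * (M / T + 1)) <= kappa ->
  exists2 c : R -> 'cV[R]_m.+2, persistently_exciting a b T c &
    ((expR (- kappa) * M / 64)%:E <= L2gain c)%E.
Proof.
move=> a0 ab T0 S0 p0 q0 pq1 hA hB M0 hM.
have b0 := lt_le_trans a0 ab.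
set w := p * q; have w0 : 0 < w by rewrite mulr_gt0.
have [g [cg gT gD g1]] := periodic_bumps m.+2 T0.
(* The first two components share the bump [g0]; each later one has its own, so the integral in (PE)
   is a 2 x 2 block for the line followed by [a] times the identity. *)
pose g0 := g ord0; pose g2 (k : 'I_m) := g (lift ord0 (lift ord0 k)).
have g02 k r : g0 r * g2 k r = 0 by apply: gD.
have g2D j k r : j != k -> g2 j r * g2 k r = 0.
  by move=> jk; apply: gD; rewrite !(inj_eq lift_inj).
pose h r := g0 r ^+ 2.
have cg2 i : continuous (fun r => g i r ^+ 2) by exact: continuous_sqr.
have ch : continuous h by exact: cg2.
(* The internal time of the line, that is the integral of |c|^2 over its two components; it advances
   by [S] per period. *)
pose sigma (r : R) := S * (prim h r - prim h 0).
have dsigma (r : R) : 0 <= r -> is_derive r 1 sigma (S * h r).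
  move=> r0; have := is_derive_scale S (is_derive_add (is_derive_prim ch r0) (is_derive_cst (- prim h 0) r 1)).
  by rewrite addr0.
have csigma : hcont sigma by exact: hcont_derive dsigma.
have gT2 i r : g i (r + T) ^+ 2 = g i r ^+ 2 by rewrite gT.
have sigma_le (r : R) : 0 <= r -> 0 <= sigma r <= S * (r / T + 1).
  move=> r0; rewrite /sigma -prim_itg//; apply/andP; split.
    by rewrite mulr_ge0 ?(ltW S0)//; apply: itg_ge0 => ? _; exact: sqr_ge0.
  rewrite ler_pM2l//.
  exact: itg_period_le ch T0 (gT2 ord0) (fun q => sqr_ge0 _) (g1 ord0) r0.
have sigmaT (t : R) : 0 <= t -> sigma (t + T) = sigma t + S.
  move=> t0; have tT : t <= t + T by rewrite lerDl ltW.
  have := itg_period ch T0 (gT2 ord0) t0; rewrite g1 prim_itg// => H.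
  have -> : sigma t + S = S * (prim h t + 1 - prim h 0) by rewrite /sigma; ring.
  by rewrite -H /sigma; congr (_ * _); ring.
pose c (r : R) : 'cV[R]_m.+2 := \col_i
  (if i == ord0 then Num.sqrt S * g0 r * cos (w * sigma r)
   else if i == lift ord0 ord0 then Num.sqrt S * g0 r * sin (w * sigma r)
   else Num.sqrt a * g i r).
have c0 r : c r ord0 0 = Num.sqrt S * g0 r * cos (w * sigma r) by rewrite mxE.
have c1 r : c r (lift ord0 ord0) 0 = Num.sqrt S * g0 r * sin (w * sigma r) by rewrite mxE.
have c2 r k : c r (lift ord0 (lift ord0 k)) 0 = Num.sqrt a * g2 k r by rewrite mxE.
have sa : Num.sqrt a ^+ 2 = a by rewrite sqr_sqrtr// ltW.
have sS : Num.sqrt S ^+ 2 = S by rewrite sqr_sqrtr// ltW.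
have cwsigma : hcont (fun r => w * sigma r) by apply: hcontM => //; exact: hcont_cst.
have ccos : hcont (fun r => cos (w * sigma r)) by apply: hcont_comp => //; exact: continuous_cos.
have csin : hcont (fun r => sin (w * sigma r)) by apply: hcont_comp => //; exact: continuous_sin.
have cSg : hcont (fun r => Num.sqrt S * g0 r).
  by apply: hcontM; [exact: hcont_cst|apply: continuous_hcont; exact: cg].
have cc i : hcont (fun r => c r i 0).
  have [->|i0] := eqVneq i ord0.
    by rewrite (funext (fun r => c0 r)); exact: hcontM.
  have [->|i1] := eqVneq i (lift ord0 ord0).
    by rewrite (funext (fun r => c1 r)); exact: hcontM.
  rewrite (_ : (fun r => c r i 0) = (fun r => Num.sqrt a * g i r)); last first.
    by apply/funext => r; rewrite mxE (negbTE i0) (negbTE i1).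
  by apply: hcontM; [exact: hcont_cst|apply: continuous_hcont; exact: cg].
exists c.
  apply/persistently_excitingP; split.
  - by move=> i; apply: locint_measurable; exact: hcont_locint.
  - by move=> i j; apply/hcont_locint/hcontM.
  - move=> t v t0; have tT : t <= t + T by rewrite lerDl ltW.
    set v0 := v ord0 0; set v1 := v (lift ord0 ord0) 0.
    pose v2 k := v (lift ord0 (lift ord0 k)) 0.
    have sqnv : sqn v = (v0 ^+ 2 + v1 ^+ 2) + \sum_k v2 k ^+ 2.
      by rewrite /dot big_ord_recl2 !expr2; congr (_ + _); apply: eq_bigr => k _; rewrite expr2.
    have dotE r : dot v (c r) ^+ 2 =
        (v0 * cos (w * sigma r) + v1 * sin (w * sigma r)) ^+ 2 * (S * h r) +
        \sum_k (a * v2 k ^+ 2) * g2 k r ^+ 2.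
      rewrite /dot big_ord_recl2 c0 c1.
      under eq_bigr do rewrite c2.
      set B := \sum_k _.
      set A := v0 * cos (w * sigma r) + v1 * sin (w * sigma r).
      have AB : g0 r * B = 0.
        rewrite mulr_sumr big1// => k _.
        by rewrite [LHS](_ : _ = v2 k * Num.sqrt a * (g0 r * g2 k r)); [rewrite g02 mulr0|rewrite /v2; ring].
      rewrite [LHS](_ : _ = A ^+ 2 * (Num.sqrt S ^+ 2 * g0 r ^+ 2) + 2 * A * Num.sqrt S * (g0 r * B) + B ^+ 2); last first.
        by rewrite /A /v0 /v1; ring.
      rewrite AB mulr0 addr0 sS; congr (_ + _).
      rewrite sqr_sum_orthogonal.
        by apply: eq_bigr => k _; rewrite !exprMn sa /v2; ring.
      move=> j k jk; rewrite [LHS](_ : _ = v2 j * v2 k * Num.sqrt a ^+ 2 * (g2 j r * g2 k r)).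
        by rewrite g2D// mulr0.
      by rewrite /v2; ring.
    have d1 (r : R) : 0 <= r -> is_derive r 1 (fun r => rot_mass w v0 v1 (sigma r))
        ((v0 * cos (w * sigma r) + v1 * sin (w * sigma r)) ^+ 2 * (S * h r)).
      move=> r0; apply: is_derive_chain (dsigma r r0) _.
      by apply: is_derive_rot_mass; rewrite gt_eqF.
    have cQ : hcont (fun r => (v0 * cos (w * sigma r) + v1 * sin (w * sigma r)) ^+ 2 * (S * h r)).
      apply: hcontM; first apply: hcontX.
        by apply: hcontD; apply: hcontM => //; exact: hcont_cst.
      by apply: hcontM; [exact: hcont_cst|exact: continuous_hcont].
    have lk k : locint (fun r => (a * v2 k ^+ 2) * g2 k r ^+ 2).
      by apply/locintZ/continuous_locint; exact: cg2.
    have -> : itg t (t + T) (fun r => dot v (c r) ^+ 2) =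
        rot_mass w v0 v1 (sigma t + S) - rot_mass w v0 v1 (sigma t) + a * \sum_k v2 k ^+ 2.
      rewrite (eq_itg (fun r _ => dotE r)) itgD//; last 2 first.
      - exact: hcont_locint.
      - by apply: locint_sum => k _.
      congr (_ + _); first by rewrite (itg_derive d1 cQ t0 tT) sigmaT.
      rewrite itg_sum// mulr_sumr; apply: eq_bigr => k _.
      rewrite itgZ//; last by apply: continuous_locint; exact: cg2.
      by rewrite (itg_period (cg2 _) T0 _ t0) ?g1 ?mulr1.
    have := rot_mass_shift v0 v1 (sigma t) S w0.
    rewrite ler_norml sqnv => /andP[h1 h2].
    have V0 : 0 <= v0 ^+ 2 + v1 ^+ 2 by rewrite addr_ge0// sqr_ge0.
    have V2 : 0 <= \sum_k v2 k ^+ 2 by apply: sumr_ge0 => k _; exact: sqr_ge0.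
    have h3 := ler_wpM2l V0 hA; have h4 := ler_wpM2l V0 hB.
    have h5 := ler_wpM2r V2 ab.
    move: h1 h2 h3 h4 h5; rewrite -/w.
    set X := `|_| / _; set N := v0 ^+ 2 + _; set N2 := \sum_k _.
    set Q := rot_mass w v0 v1 (_ + _) - _.
    by move=> h1 h2 h3 h4 h5; apply/andP; split; lra.
pose e (r : R) := expR (- p ^+ 2 * sigma r).
(* The vector (p, q) turned by the angle w sigma: p along the line, q across it. *)
pose x0 (r : R) := e r * (p * cos (w * sigma r) + - q * sin (w * sigma r)).
pose x1 (r : R) := e r * (p * sin (w * sigma r) + q * cos (w * sigma r)).
pose xi (r : R) : 'cV[R]_m.+2 := \col_i
  (if i == ord0 then x0 r else if i == lift ord0 ord0 then x1 r else 0).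
have xi0 r : xi r ord0 0 = x0 r by rewrite mxE.
have xi1 r : xi r (lift ord0 ord0) 0 = x1 r by rewrite mxE.
have xi2 r k : xi r (lift ord0 (lift ord0 k)) 0 = 0 by rewrite mxE.
have cxi r : dot (c r) (xi r) = Num.sqrt S * g0 r * e r * p.
  rewrite /dot big_ord_recl2 big1 ?addr0; last by move=> k _; rewrite xi2 mulr0.
  rewrite c0 c1 xi0 xi1 /x0 /x1.
  rewrite -[RHS]mulr1 -(cos2Dsin2 (w * sigma r)); ring.
have sqnxi r : sqn (xi r) = e r ^+ 2.
  rewrite /dot big_ord_recl2 big1 ?addr0; last by move=> k _; rewrite xi2 mulr0.
  rewrite xi0 xi1 /x0 /x1 [LHS](_ : _ = e r ^+ 2 * (p ^+ 2 + q ^+ 2) *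
     (cos (w * sigma r) ^+ 2 + sin (w * sigma r) ^+ 2)); last by ring.
  by rewrite pq1 cos2Dsin2 !mulr1.
have de (r : R) : 0 <= r -> is_derive r 1 e (e r * (- p ^+ 2 * (S * h r))).
  move=> r0; exact: is_derive_chain (is_derive_scale (- p ^+ 2) (dsigma r r0)) (is_derive_expR _).
have dcos (r : R) : 0 <= r -> is_derive r 1 (fun r => cos (w * sigma r)) (- (w * sin (w * sigma r)) * (S * h r)).
  by move=> r0; exact: is_derive_chain (dsigma r r0) (is_derive_cos_scale w (sigma r)).
have dsin (r : R) : 0 <= r -> is_derive r 1 (fun r => sin (w * sigma r)) (w * cos (w * sigma r) * (S * h r)).
  by move=> r0; exact: is_derive_chain (dsigma r r0) (is_derive_sin_scale w (sigma r)).
apply: (@L2gain_ge _ _ c xi M (expR (- kappa))) => //.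
- move=> i t t0; have D1 := de t t0; have D2 := dcos t t0; have D3 := dsin t t0.
  rewrite cxi.
  have [->|i0] := eqVneq i ord0.
    rewrite (_ : (fun r => xi r ord0 0) = x0); last by apply/funext => ?; exact: xi0.
    apply: (is_derive_eq (is_derive_mul D1 (is_derive_add (is_derive_scale p D2)
       (is_derive_scale (- q) D3)))).
    (* The factor p^2 + q^2, equal to 1, is inserted so that the derivative matches as a polynomial
       identity. *)
    rewrite c0 [RHS](_ : _ = - (p * cos (w * sigma t)) * (p ^+ 2 + q ^+ 2) * (Num.sqrt S ^+ 2 * h t * e t)).
      by rewrite sS /w /h; ring.
    by rewrite pq1 /h; ring.
  have [->|i1] := eqVneq i (lift ord0 ord0).
    rewrite (_ : (fun r => xi r (lift ord0 ord0) 0) = x1); last by apply/funext => ?; exact: xi1.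
    apply: (is_derive_eq (is_derive_mul D1 (is_derive_add (is_derive_scale p D3)
       (is_derive_scale q D2)))).
    rewrite c1 [RHS](_ : _ = - (p * sin (w * sigma t)) * (p ^+ 2 + q ^+ 2) * (Num.sqrt S ^+ 2 * h t * e t)).
      by rewrite sS /w /h; ring.
    by rewrite pq1 /h; ring.
  rewrite (_ : (fun r => xi r i 0) = cst 0); last first.
    by apply/funext => r; rewrite mxE (negbTE i0) (negbTE i1).
  have -> : c t i 0 = Num.sqrt a * g i t by rewrite mxE (negbTE i0) (negbTE i1).
  rewrite [X in is_derive _ _ _ X](_ : _ = - (Num.sqrt a * Num.sqrt S * e t * p) * (g i t * g0 t)); last by ring.
  by rewrite gD// mulr0; exact: is_derive_cst.
- exact: expR_gt0.
- move=> t /andP[t0 tM]; rewrite sqnxi.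
  have /andP[s0 s1] := sigma_le t t0.
  have tT : t / T <= M / T by rewrite ler_pM2r// invr_gt0.
  have p2 : 0 <= p ^+ 2 by exact: sqr_ge0.
  have ps : p ^+ 2 * sigma t <= kappa.
    apply: le_trans hM; apply: ler_wpM2l => //; apply: (le_trans s1).
    by rewrite ler_pM2l// lerD2r.
  apply/andP; split.
    by rewrite ler_pXn2r ?nnegrE ?expR_ge0// ler_expR mulNr lerN2.
  by rewrite exprn_ile1 ?expR_ge0// -expR0 ler_expR mulNr oppr_le0 mulr_ge0.
Qed.

End RotatingLine.

(** * Elementary trigonometric estimates *)

Section Trigonometry.
Context {R : realType}.
Implicit Types (x : R).

Lemma sin_MVT x : 0 <= x -> exists2 y, 0 <= y <= x & sin x = cos y * x.
Proof.
move=> x0.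
have [y yx] := @MVT_segment R sin cos 0 x x0 (fun y _ => is_derive_sin y)
  (continuous_subspaceT (@continuous_sin R)).
by rewrite sin0 !subr0 => E; exists y.
Qed.

Lemma sin_le x : 0 <= x -> sin x <= x.
Proof.
by move=> x0; have [y _ ->] := sin_MVT x0; rewrite ler_piMl// cos_le1.
Qed.

(** The mean value theorem gives sin x = x cos y with cos y >= cos x >= 1/2, so x^2 <= 4 (sin x)^2 =
    4 (1 - cos x) (1 + cos x). *)
Lemma sqr_le_1Bcos x : 0 <= x <= pi -> 1 / 2 <= cos x -> x ^+ 2 <= 8 * (1 - cos x).
Proof.
move=> /andP[x0 xpi] hc.
have [y /andP[y0 yx] E] := sin_MVT x0.
have cy : cos x <= cos y.
  rewrite leNgt ltr_cos ?in_itv/= ?y0 ?x0 ?(le_trans yx)// -leNgt//.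
have h1 : x <= 2 * sin x.
  rewrite E mulrA ler_peMl//; lra.
have h2 : x ^+ 2 <= (2 * sin x) ^+ 2 by rewrite ler_pXn2r ?nnegrE ?(le_trans x0).
apply: (le_trans h2); rewrite exprMn sin2cos2.
have := cos_le1 x; nra.
Qed.

End Trigonometry.

(** * Choice of the turning speed for large [b] *)

Section LargeExcitation.
Context {R : realType}.
Implicit Types (a b T S w : R).

(** With p q = w and p^2 + q^2 = 1, the rate p^2 is the smaller root of l (1 - l) = w^2, hence at
    most 2 w^2, so a period adds at most 128 a / b^2 to the decay exponent. The horizon is b^2 /
    (128 a) periods, which contribute at most 1; the rounding period contributes at most 16. *)
Lemma L2gain_rotating_slow m a b T S w : 0 < a -> a <= b -> 8 <= b -> 0 < T -> 0 < S ->
  0 < w -> w <= 2^-1 ->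
  a <= S / 2 - `|sin (w * S)| / (2 * w) ->
  S / 2 + `|sin (w * S)| / (2 * w) <= b ->
  2 * w ^+ 2 * S <= 128 * a / b ^+ 2 ->
  exists2 c : R -> 'cV[R]_m.+2, persistently_exciting a b T c &
    ((expR (- 17) * (T * b ^+ 2 / (128 * a)) / 64)%:E <= L2gain c)%E.
Proof.
move=> a0 ab b8 T0 S0 w0 w1 hA hB hS.
have b0 : 0 < b by rewrite (lt_le_trans _ b8).
have b20 : 0 < b ^+ 2 by rewrite exprn_gt0.
(* The discriminant of l (1 - l) = w^2, nonnegative because w <= 1/2. *)
have w2 : 0 <= 1 - 4 * w ^+ 2 by rewrite expr2; nra.
set d := Num.sqrt (1 - 4 * w ^+ 2).
have d0 : 0 <= d by rewrite sqrtr_ge0.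
have d2 : d ^+ 2 = 1 - 4 * w ^+ 2 by rewrite sqr_sqrtr.
have d1 : d < 1.
  have ww : 0 < w ^+ 2 by rewrite exprn_gt0.
  rewrite ltNge; apply/negP => h; nra.
pose l := (1 - d) / 2.
have l0 : 0 < l by rewrite /l; lra.
have l1 : 0 < 1 - l by rewrite /l; lra.
have lw : l * (1 - l) = w ^+ 2.
  by rewrite [LHS](_ : _ = (1 - d ^+ 2) / 4); [rewrite d2; field|rewrite /l; field].
have l2 : l <= 2 * w ^+ 2 by rewrite -lw /l; nra.
pose p := Num.sqrt l; pose q := Num.sqrt (1 - l).
have p2 : p ^+ 2 = l by rewrite sqr_sqrtr// ltW.
have q2 : q ^+ 2 = 1 - l by rewrite sqr_sqrtr// ltW.
have p0 : 0 < p by rewrite sqrtr_gt0.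
have q0 : 0 < q by rewrite sqrtr_gt0.
have pqw : p * q = w.
  by rewrite -sqrtrM ?(ltW l0)// lw sqrtr_sqr ger0_norm// ltW.
have M0 : 0 < T * b ^+ 2 / (128 * a) by rewrite divr_gt0 ?mulr_gt0.
apply: (@L2gain_rotating _ m a b T S p q _ 17) => //; rewrite ?pqw//.
  by rewrite p2 q2 addrC subrK.
rewrite p2.
have -> : T * b ^+ 2 / (128 * a) / T = b ^+ 2 / (128 * a).
  by field; rewrite !gt_eqF.
have lS : l * S <= 128 * a / b ^+ 2.
  by apply: le_trans hS; rewrite ler_pM2r.
have A0 : 0 <= b ^+ 2 / (128 * a) + 1 by rewrite addr_ge0// divr_ge0 ?sqr_ge0 ?mulr_ge0 ?ltW.
rewrite mulrA; apply: le_trans (ler_wpM2r A0 lS) _.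
rewrite mulrDr mulr1.
have -> : 128 * a / b ^+ 2 * (b ^+ 2 / (128 * a)) = 1 by field; rewrite !gt_eqF.
(* From a <= b and b >= 8. *)
have : 128 * a / b ^+ 2 <= 16.
  rewrite ler_pdivrMr// expr2; nra.
lra.
Qed.

Lemma L2gain_large m a b T : 0 < a -> a <= b -> 8 <= b -> 0 < T ->
  exists2 c : R -> 'cV[R]_m.+2, persistently_exciting a b T c &
    ((expR (- 17) * (T * b ^+ 2 / (128 * a)) / 64)%:E <= L2gain c)%E.
Proof.
move=> a0 ab b8 T0.
have b0 : 0 < b by rewrite (lt_le_trans _ b8).
have p4 : pi < 4 :> R by have := @pihalf_lt2 R; lra.
have pi0 := @pi_gt0 R.
(* Half a turn per period is isotropic; if a < b / 4 turn by 2 t per period,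
   where cos t = 1 - 2 a / b, so that sin (2 t) / (2 t) <= 1 - 2 a / b. *)
have [ba|ab4] := leP b (4 * a).
  have w0 : 0 < pi / (2 * b) by rewrite divr_gt0 ?mulr_gt0.
  have E : pi / (2 * b) * (2 * b) = pi by rewrite divfK// gt_eqF ?mulr_gt0.
  (* With S = 2 b and w S = pi the sine vanishes, and the block of the line is exactly [b] times the
     identity. *)
  apply: (@L2gain_rotating_slow m a b T (2 * b) (pi / (2 * b))) => //.
  - by rewrite mulr_gt0.
  - by rewrite ler_pdivrMr ?mulr_gt0//; lra.
  - by rewrite E sinpi normr0 mul0r subr0; lra.
  - by rewrite E sinpi normr0 mul0r addr0; lra.
  - have -> : 2 * (pi / (2 * b)) ^+ 2 * (2 * b) = pi ^+ 2 * b / b ^+ 2.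
      by field; rewrite gt_eqF.
    rewrite ler_pM2r ?invr_gt0 ?exprn_gt0//.
    have : pi ^+ 2 <= 16 :> R by rewrite expr2; nra.
    nra.
pose z := 1 - 2 * a / b.
have ab' : a / b < 1 / 4 by rewrite ltr_pdivrMr//; lra.
have ab0 : 0 < a / b by rewrite divr_gt0.
have zI : -1 <= z <= 1 by rewrite /z -mulrA; lra.
have z2 : 1 / 2 <= z by rewrite /z -mulrA; lra.
have z1 : z < 1 by rewrite /z -mulrA; lra.
pose t := acos z.
have ct : cos t = z by rewrite acosK// in_itv.
have t0 : 0 < t by rewrite acos_gt0// z1 andbT; case/andP: zI.
have tpi : t <= pi by exact: acos_lepi.
(* Source of the constant 128: with w = 2 t / b and S = b, the quantity 2 w^2 S is 8 t^2 / b. *)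
have t2 : t ^+ 2 <= 16 * (a / b).
  have : t ^+ 2 <= 8 * (1 - cos t) by apply: sqr_le_1Bcos; rewrite ?(ltW t0)// ct.
  by rewrite ct /z; lra.
have w0 : 0 < 2 * t / b by rewrite divr_gt0 ?mulr_gt0.
have E : 2 * t / b * b = t *+ 2 by rewrite divfK ?gt_eqF// mulr_natl.
have st0 : 0 <= sin t by rewrite sin_ge0_pi// (ltW t0).
(* The left side is (b/2) cos t (sin t / t), at most (b/2) cos t = b/2 - a. With S = b the
   eigenvalues therefore lie between a and b - a. *)
have sn : `|sin (t *+ 2)| / (2 * (2 * t / b)) <= b / 2 - a.
  rewrite sin_mulr2n ger0_norm; last by rewrite mulrn_wge0// mulr_ge0// ct; lra.
  rewrite ct ler_pdivrMr ?mulr_gt0 ?invr_gt0//.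
  have -> : (b / 2 - a) * (2 * (2 * t / b)) = (z * t) *+ 2.
    by rewrite /z -mulr_natl; field; rewrite gt_eqF.
  by rewrite lerMn2r/= ler_pM2l ?sin_le ?ltW//; lra.
apply: (@L2gain_rotating_slow m a b T b (2 * t / b)) => //.
- rewrite ler_pdivrMr//.
  have : t ^+ 2 <= 4 by lra.
  move=> h; have : t <= 2 by rewrite -(@ler_pXn2r _ 2)// ?nnegrE ?(ltW t0)//; lra.
  lra.
- by rewrite E; lra.
- by rewrite E; lra.
- have -> : 2 * (2 * t / b) ^+ 2 * b = 8 * t ^+ 2 / b by field; rewrite gt_eqF.
  have -> : 128 * a / b ^+ 2 = 8 * (16 * (a / b)) / b by field; rewrite gt_eqF.
  by rewrite ler_pM2r ?invr_gt0// ler_pM2l.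
Qed.

End LargeExcitation.

(** * Assembly of the two bounds *)

Theorem theorem1p3 (R : realType) :
  exists c1 c2 : R, [/\ 0 < c1, 0 < c2 &
    forall (a b T : R) (n : nat), 0 < a -> a <= b -> 0 < T -> (2 <= n)%N ->
      ((c1 * (T * (1 + b ^+ 2) / a))%:E <= worst_L2gain a b T n)%E /\
      (worst_L2gain a b T n <= (c2 * (T * (1 + n%:R * b ^+ 2) / a))%:E)%E].
Proof.
have p64 : 0 < 64 :> R by rewrite ltr0n.
have p256 : 0 < 256 :> R by rewrite ltr0n.
(* The 17 and the 64 come from [L2gain_large]; 256 is twice its 128, since 1 + b^2 <= 2 b^2 for b >=
   8. The 5 comes from [L2gain_le]. *)
exists (expR (- 17) / 64 / 256), 5; split.
- exact: divr_gt0 (divr_gt0 (expR_gt0 _) p64) p256.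
- by [].
move=> a b T [//|[//|m]] a0 ab T0 _.
have Ta0 : 0 < T / a by exact: divr_gt0.
split; last first.
  by apply: ge_ereal_sup => _ [c PEc <-]; exact: L2gain_le.
apply: le_ereal_sup_tmp.
have [b8|b8] := leP 8 b.
  have [c PEc hc] := L2gain_large m a0 ab b8 T0.
  exists (L2gain c); first by exists c.
  apply: le_trans hc; rewrite lee_fin.
  rewrite [leLHS](_ : _ = expR (- 17) / 64 / 256 * (T / a) * (1 + b ^+ 2)); last first.
    by field; rewrite gt_eqF.
  rewrite [leRHS](_ : _ = expR (- 17) / 64 / 256 * (T / a) * (2 * b ^+ 2)); last first.
    by field; rewrite gt_eqF.
  rewrite (ler_pM2l (mulr_gt0 (divr_gt0 (divr_gt0 (expR_gt0 _) p64) p256) Ta0)).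
  by rewrite expr2; nra.
(* Here a <= b < 8, so 1 + a <= 17 and 1 + b^2 <= 256. *)
have [c PEc hc] := L2gain_decoupled m.+1 a0 ab T0.
exists (L2gain c); first by exists c.
apply: le_trans hc; rewrite lee_fin.
rewrite [leLHS](_ : _ = T / a / 64 * (expR (- 17) * ((1 + b ^+ 2) / 256))); last first.
  by field; rewrite gt_eqF.
rewrite [leRHS](_ : _ = T / a / 64 * (expR (- (1 + a)) * 1)); last first.
  by field; rewrite gt_eqF.
rewrite (ler_pM2l (divr_gt0 Ta0 p64)); apply: ler_pM.
- exact: expR_ge0.
- exact: divr_ge0 (addr_ge0 ler01 (sqr_ge0 b)) (ltW p256).
- by rewrite ler_expR; lra.
- by rewrite (ler_pdivrMr _ _ p256) expr2; nra.
Qed.
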